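(* Assume $\mu\ne0$, and let $(u,a^* )$ be the pair constructed in the context. Then $(u,a^* )$ is the unique pair $(v,b)$, with $b\in(0,1)$ and $v\in\mathcal C([0,1])\cap\mathcal C^1([0,1))\cap\mathcal C^2([0,1)\setminus\mathcal D_b)$, that solves the free boundary problem \begin{align*} &(\mathcal Lv)(\pi)=-\beta\pi, && \pi\in(0,b),\\ &v(\pi)=(\mathcal Av)(\pi), && \pi\in[b,1),\\ &v'(b)=(\mathcal Av)'(b),\\ &\lim_{\pi\downarrow0}|v'(\pi)|<\infty,\\ &(\mathcal Lv)(\pi)\ge-\beta\pi, && \pi\in(0,1)\setminus\mathcal D_b,\\ &v(\pi)\le(\mathcal Av)(\pi), && \pi\in[0,1). \end{align*} Moreover $a^*\in(0,1)$, $u$ is concave and $u\in\mathcal C([0,1])\cap\mathcal C^1([0,1))\cap\mathcal C^2([0,1)\setminus\mathcal D_{a^*})$.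
   Context: Parameters: $\lambda>0$, $\beta>0$, $\mu\in\mathbb R$, $\sigma>0$, $\epsilon\in[0,1)$; $\gamma=\mu^2/(2\sigma^2)$, $\rho=\lambda/\gamma$; $\mathbb N=\{1,2,\dots\}$. $\mathcal C^m(J)$ is the set of $m$-times continuously differentiable functions on $J$; at the endpoint $0$, derivatives are understood as continuous extensions from $(0,1)$. $(\mathcal Lf)(\pi)=\lambda(1-\pi)f'(\pi)+\gamma\pi^2(1-\pi)^2f''(\pi)$. $g(\pi)=\dfrac{\epsilon\pi}{1-(1-\epsilon)\pi}$ on $[0,1]$ (with $g(1):=0$ if $\epsilon=0$). For $\epsilon\in(0,1)$, $g^{-1}(q)=\dfrac{q}{\epsilon+q(1-\epsilon)}$, $q\in[0,1]$; for $\epsilon=0$, $g^{-1}(0)=0$ and $g^{-1}(q)=1$ for $q\in(0,1]$. $g^{-k}$ is the $k$-fold composition of $g^{-1}$, $g^0(q)=q$. For $a\in(0,1)$, $\mathcal D_a=\{a,g^{-1}(a),g^{-2}(a),\dots\}\cap[0,1)$. $(\mathcal Av)(\pi)=1+[1-(1-\epsilon)\pi]\,v(g(\pi))$ and $\mathcal A^k$ is the $k$-fold application of $\mathcal A$. For $\pi\in(0,1)$: $h(\pi)=\rho\{\log\frac{\pi}{1-\pi}-\frac1\pi\}$, $\psi(\pi)=-\frac{\beta}{\gamma}e^{-h(\pi)}\int_0^\pi\frac{e^{h(x)}}{x(1-x)^2}dx$, $\Psi(\pi)=\int_0^\pi\psi(x)dx$, with $\psi(0)=\Psi(0)=0$ by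 continuity. Construction of $(u,a^* )$: $(C,a^* )$, with $a^*\in(0,1)$, is the (unique) solution of the system $$C+\Psi(a^* )=1+[1-(1-\epsilon)a^*]\,[C+\Psi(g(a^* ))],$$ $$\psi(a^* )=-(1-\epsilon)[C+\Psi(g(a^* ))]+\frac{\epsilon}{1-(1-\epsilon)a^*}\psi(g(a^* )).$$ With $J^*_k=[g^{-(k-1)}(a^* ),g^{-k}(a^* ))$ for $k\in\mathbb N$ (the sets $[0,a^* ),J_1^*,J_2^*,\dots$ cover $[0,1)$), set $u(\pi)=\Psi(\pi)+C$ for $\pi\in[0,a^* )$ and $u(\pi)=[\mathcal A^k(\Psi+C)](\pi)$ for $\pi\in J_k^*$, $k\in\mathbb N$; $u(1)$ is defined by continuity. *)

(* Defs.v *)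
From Stdlib Require Export Reals ClassicalEpsilon.
From Coquelicot Require Export Coquelicot.

Open Scope R_scope.

Definition gamma (mu sigma : R) : R := mu ^ 2 / (2 * sigma ^ 2).

(* Coquelicot's [continuous_on J] is continuity relative to [J].  The
   derivatives of order 1, ..., m are taken at the points of [J] in (0,1), and
   [w] is the continuous extension of such a derivative to all of [J]; at the
   endpoint 0 no one-sided difference quotient is involved. *)
Definition C_class (m : nat) (J : R -> Prop) (f : R -> R) : Prop :=
  continuous_on J f /\
  forall k : nat, (1 <= k <= m)%nat ->
    (forall x, J x -> 0 < x < 1 -> ex_derive_n f k x) /\
    exists w : R -> R,
      continuous_on J w /\
      forall x, J x -> 0 < x < 1 -> w x = Derive_n f k x.

Definition concave_on (J : R -> Prop) (f : R -> R) : Prop :=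
  forall x y t, J x -> J y -> 0 <= t <= 1 ->
    t * f x + (1 - t) * f y <= f (t * x + (1 - t) * y).

Definition opL (lambda gam : R) (f : R -> R) (x : R) : R :=
  lambda * (1 - x) * Derive f x +
  gam * x ^ 2 * (1 - x) ^ 2 * Derive_n f 2 x.

(* For [eps = 0] this is identically 0, including at [x = 1], where the total
   division gives 0 / 0 = 0. *)
Definition g (eps x : R) : R := eps * x / (1 - (1 - eps) * x).

(* For [eps = 0] this is q / q: 1 for q > 0, and 0 / 0 = 0 at q = 0. *)
Definition ginv (eps q : R) : R := q / (eps + q * (1 - eps)).

Definition ginv_iter (eps : R) (k : nat) (q : R) : R := Nat.iter k (ginv eps) q.

Definition setD (eps a x : R) : Prop :=
  0 <= x < 1 /\ exists k : nat, x = ginv_iter eps k a.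

Definition opA (eps : R) (v : R -> R) (x : R) : R :=
  1 + (1 - (1 - eps) * x) * v (g eps x).

Definition opA_iter (eps : R) (k : nat) (v : R -> R) : R -> R :=
  Nat.iter k (opA eps) v.

(* [lambda / gam] is the parameter rho. *)
Definition h (lambda gam x : R) : R :=
  lambda / gam * (ln (x / (1 - x)) - 1 / x).

(* The integrand tends to 0 at 0+, so its (meaningless) value at the endpoint 0
   does not affect the Riemann integral. *)
Definition psi (lambda beta gam x : R) : R :=
  if Rlt_dec 0 x then
    - (beta / gam) * exp (- h lambda gam x) *
      RInt (fun y => exp (h lambda gam y) / (y * (1 - y) ^ 2)) 0 x
  else 0.

Definition Psi (lambda beta gam x : R) : R := RInt (psi lambda beta gam) 0 x.

Definition solves_system (lambda beta gam eps C a : R) : Prop :=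
  0 < a < 1 /\
  C + Psi lambda beta gam a =
    1 + (1 - (1 - eps) * a) * (C + Psi lambda beta gam (g eps a)) /\
  psi lambda beta gam a =
    - (1 - eps) * (C + Psi lambda beta gam (g eps a)) +
    eps / (1 - (1 - eps) * a) * psi lambda beta gam (g eps a).

(* Piece 0 is [0, a), and piece k is J_k = [g^-(k-1)(a), g^-k(a)) for k >= 1. *)
Definition in_piece (eps a : R) (k : nat) (x : R) : Prop :=
  match k with
  | O => 0 <= x < a
  | S j => ginv_iter eps j a <= x < ginv_iter eps (S j) a
  end.

Definition piece_index (eps a x : R) : nat :=
  epsilon (inhabits 0%nat) (fun k => in_piece eps a k x).

Definition u_left (lambda beta gam eps C a x : R) : R :=
  opA_iter eps (piece_index eps a x) (fun y => Psi lambda beta gam y + C) x.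

(* The value at 1 is the limit from the left; only [0,1] is meaningful. *)
Definition u (lambda beta gam eps C a x : R) : R :=
  if Rlt_dec x 1 then u_left lambda beta gam eps C a x
  else iota (fun l : R =>
    filterlim (u_left lambda beta gam eps C a) (at_left 1) (locally l)).

Definition regular (eps b : R) (v : R -> R) : Prop :=
  C_class 0 (fun x => 0 <= x <= 1) v /\
  C_class 1 (fun x => 0 <= x < 1) v /\
  C_class 2 (fun x => 0 <= x < 1 /\ ~ setD eps b x) v.

Definition solves_fbp (lambda beta gam eps : R) (v : R -> R) (b : R) : Prop :=
  0 < b < 1 /\
  regular eps b v /\
  (forall x, 0 < x < b -> opL lambda gam v x = - beta * x) /\
  (forall x, b <= x < 1 -> v x = opA eps v x) /\
  Derive v b = Derive (opA eps v) b /\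
  (exists l : R,
     filterlim (fun x => Rabs (Derive v x)) (at_right 0) (locally l)) /\
  (forall x, 0 < x < 1 -> ~ setD eps b x -> opL lambda gam v x >= - beta * x) /\
  (forall x, 0 <= x < 1 -> v x <= opA eps v x).

(* Main.v *)
(*
  With h' = rho / (x^2 (1 - x)) and m = (beta / lambda) x / (1 - x), the equation L v = - beta x
  reads w' = - h' (m + w) for w = v', and psi is its only solution bounded near 0.  All sign
  information comes from one comparison principle: if w' = h' (S - w) with S' > 0 and w bounded
  near 0, then exp(h) (S - w) vanishes at 0 and has derivative exp(h) S' > 0, so w < S and
  w' > 0.  For S = m, w = - psi, it makes Psi strictly concave.

  Let N = A Psi - Psi and let T(q) = Psi(q) + (1 - q) psi(q) be the value at 1 of the tangent to
  Psi at q.  Since g maps x to eps x / D with D = 1 - (1 - eps) x, N' satisfies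
  N'' = h' (S - N') with S = (1 - eps) (m - T o g), which is increasing; so N is strictly convex.
  The system says that the line (1 - eps) C x is tangent to N at a, i.e. x N' - N vanishes at a.
  This function increases from -1 to +oo, because it equals Q o g - Q - 1 with Q = x psi - Psi.
  Convexity then gives V <= A V for V = Psi + C, and N''(a) > 0 gives C + T(g(a)) <= m(a).

  All properties of u pass from g(x) to x through u = A u on [a, 1), starting from u = V on
  [0, a).  A preserves concavity, being a perspective transformation, and
  L(A u)(x) + beta x >= (1 - eps) lambda (1 - x) (m(x) - T_u(g(x))), where T_u is T with u in
  place of Psi; the bracket increases with x and is nonnegative at a.

  Conversely, a solution (v, b) of the free boundary problem has v' = psi on (0, b), so
  (v(0), b) solves the system, and v = A v on [b, 1) determines v.
*)

From Stdlib Require Import Lra Lia Ranalysis5.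
Require Import Defs.

(* Coquelicot often leaves equations typed in [R_NormedModule], which [ring] and
   [field] do not recognize. *)
Ltac real_eq := match goal with |- ?a = ?b => change (@eq R a b) end.

(** * One-variable calculus: gluing, mean values, one-sided limits *)

Lemma is_derive_eq (f : R -> R) (x l l' : R) :
  is_derive f x l -> l = l' -> is_derive f x l'.
Proof. intros H <-; exact H. Qed.

Lemma locally_lt (x t : R) : x < t -> locally x (fun y => y < t).
Proof. intros H; apply (open_lt t x H). Qed.

Lemma locally_gt (x t : R) : t < x -> locally x (fun y => t < y).
Proof. intros H; apply (open_gt t x H). Qed.

Lemma locally_between (x s t : R) : s < x < t -> locally x (fun y => s < y < t).
Proof.
  intros [H1 H2]. apply filter_and; [apply locally_gt | apply locally_lt]; assumption.
Qed.

Lemma continuous_of_is_derive (f : R -> R) (x l : R) :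
  is_derive f x l -> continuous f x.
Proof. intros H; apply (ex_derive_continuous f x); exists l; exact H. Qed.

(** Each difference quotient of [f] at [c] is one of [f1] or of [f2], whichever branch is taken
    nearby. Applied at the free boundary, with the branches [V] and [A u]. *)
Lemma is_derive_glue (f f1 f2 : R -> R) (c l : R) :
  is_derive f1 c l -> is_derive f2 c l -> f c = f1 c -> f c = f2 c ->
  locally c (fun y => f y = f1 y \/ f y = f2 y) -> is_derive f c l.
Proof.
  intros H1 H2 E1 E2 [d Hd].
  apply is_derive_Reals. apply is_derive_Reals in H1. apply is_derive_Reals in H2.
  intros e He. destruct (H1 e He) as [d1 Hd1]. destruct (H2 e He) as [d2 Hd2].
  assert (Hm : 0 < Rmin d (Rmin d1 d2)) by (repeat apply Rmin_glb_lt; apply cond_pos).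
  exists (mkposreal _ Hm); simpl. intros t Ht Htd.
  assert (A1 := Rlt_le_trans _ _ _ Htd (Rmin_l _ _)).
  assert (A2 := Rlt_le_trans _ _ _ Htd (Rmin_r _ _)).
  assert (A3 := Rlt_le_trans _ _ _ A2 (Rmin_l _ _)).
  assert (A4 := Rlt_le_trans _ _ _ A2 (Rmin_r _ _)).
  destruct (Hd (c + t)) as [-> | ->].
  - change (Rabs (c + t - c) < d). replace (c + t - c) with t by ring. exact A1.
  - rewrite E1. apply Hd1; assumption.
  - rewrite E2. apply Hd2; assumption.
Qed.

Lemma continuous_glue (f f1 f2 : R -> R) (c : R) :
  continuous f1 c -> continuous f2 c -> f c = f1 c -> f c = f2 c ->
  locally c (fun y => f y = f1 y \/ f y = f2 y) -> continuous f c.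
Proof.
  intros H1 H2 E1 E2 Hloc P HP.
  assert (P1 : locally c (fun y => P (f1 y))) by (apply H1; rewrite <- E1; exact HP).
  assert (P2 : locally c (fun y => P (f2 y))) by (apply H2; rewrite <- E2; exact HP).
  change (locally c (fun y => P (f y))).
  generalize (filter_and _ _ Hloc (filter_and _ _ P1 P2)). apply filter_imp.
  intros y [[E | E] [Q1 Q2]]; rewrite E; assumption.
Qed.

Lemma mean_value_open (f df : R -> R) (a b : R) :
  a < b -> (forall x, a < x < b -> is_derive f x (df x)) ->
  (forall x, a <= x <= b -> continuous f x) ->
  exists c, a < c < b /\ f b - f a = df c * (b - a).
Proof.
  intros Hab Hf Hc.
  assert (pr : forall c, a < c < b -> derivable_pt f c).
  { intros c Hcc. exists (df c). apply is_derive_Reals, Hf, Hcc. }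
  destruct (MVT f id a b pr (fun c _ => derivable_pt_id c) Hab) as [c [Hcc He]].
  - intros c Hcc. apply continuity_pt_filterlim, Hc, Hcc.
  - intros c Hcc. apply derivable_continuous_pt, derivable_pt_id.
  - exists c. split; [exact Hcc |].
    replace (derive_pt id c (derivable_pt_id c)) with 1 in He
      by (symmetry; apply derive_pt_id).
    replace (derive_pt f c (pr c Hcc)) with (df c) in He.
    + unfold id in He. lra.
    + symmetry. apply derive_pt_eq_0, is_derive_Reals, Hf, Hcc.
Qed.

(** Mean values on the two sides of the intermediate point are compared. Continuity suffices at 0
    and 1, where the derivative may be missing. *)
Lemma concave_on_of_derive (f df : R -> R) :
  (forall x, 0 <= x <= 1 -> continuous f x) ->
  (forall x, 0 < x < 1 -> is_derive f x (df x)) ->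
  (forall x y, 0 < x < y -> y < 1 -> df y <= df x) ->
  concave_on (fun x => 0 <= x <= 1) f.
Proof.
  intros Hc Hd Hm.
  assert (H : forall x y t, 0 <= x -> x < y -> y <= 1 -> 0 <= t <= 1 ->
    t * f x + (1 - t) * f y <= f (t * x + (1 - t) * y)).
  { intros x y t Hx Hxy Hy Ht. set (z := t * x + (1 - t) * y).
    destruct (proj1 Ht) as [Ht0 | <-].
    2: { unfold z. replace (0 * x + (1 - 0) * y) with y by ring. lra. }
    destruct (proj2 Ht) as [Ht1 | ->].
    2: { unfold z. replace (1 * x + (1 - 1) * y) with x by ring. lra. }
    assert (Ez : z - x = (1 - t) * (y - x)) by (unfold z; ring).
    assert (Ey : y - z = t * (y - x)) by (unfold z; ring).
    assert (0 < (1 - t) * (y - x)) by (apply Rmult_lt_0_compat; lra).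
    assert (0 < t * (y - x)) by (apply Rmult_lt_0_compat; lra).
    destruct (mean_value_open f df x z) as [c1 [Hc1 E1]];
      [lra | intros; apply Hd; lra | intros; apply Hc; lra |].
    destruct (mean_value_open f df z y) as [c2 [Hc2 E2]];
      [lra | intros; apply Hd; lra | intros; apply Hc; lra |].
    assert (Hmc := Hm c1 c2 ltac:(lra) ltac:(lra)).
    rewrite Ez in E1. rewrite Ey in E2.
    assert (0 <= (df c1 - df c2) * (t * ((1 - t) * (y - x)))).
    { apply Rmult_le_pos; [lra |]. apply Rmult_le_pos; lra. }
    assert (t * (f z - f x) - (1 - t) * (f y - f z) =
      (df c1 - df c2) * (t * ((1 - t) * (y - x)))) by (rewrite E1, E2; ring).
    lra. }
  intros x y t Hx Hy Ht. destruct (Rtotal_order x y) as [L | [-> | L]].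
  - apply H; lra.
  - replace (t * y + (1 - t) * y) with y by ring. lra.
  - assert (Q := H y x (1 - t) ltac:(lra) L ltac:(lra) ltac:(lra)).
    replace (t * x + (1 - t) * y) with ((1 - t) * y + (1 - (1 - t)) * x) by ring. lra.
Qed.

(** Monotone convergence. The limit is the infimum, obtained as minus the supremum of [- f] because
    [completeness] yields least upper bounds. *)
Lemma nonincreasing_limit_left (f : R -> R) :
  (forall x y, 0 <= x <= y -> y < 1 -> f y <= f x) ->
  (forall x, 0 <= x < 1 -> 0 <= f x) ->
  exists l, filterlim f (at_left 1) (locally l).
Proof.
  intros Hm Hp.
  destruct (completeness (fun z => exists x, 0 <= x < 1 /\ z = - f x)) as [s [Hs1 Hs2]].
  - exists 0. intros z [x [Hx ->]]. generalize (Hp x Hx); lra.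
  - exists (- f 0), 0. split; [lra | reflexivity].
  - exists (- s). apply filterlim_locally; intros e.
    assert (Hx : exists x, 0 <= x < 1 /\ s - e < - f x).
    { apply not_all_not_ex; intros Hn.
      assert (s <= s - e); [| generalize (cond_pos e); lra].
      apply Hs2. intros z [x [Hx ->]]. apply Rnot_lt_le; intros Hlt. apply (Hn x); auto. }
    destruct Hx as [x [Hx Hxe]].
    change (locally 1 (fun y => y < 1 -> ball (- s) e (f y))).
    generalize (locally_gt 1 x (proj2 Hx)). apply filter_imp. intros y Hy Hy1.
    change (Rabs (f y - - s) < e).
    assert (- f y <= s) by (apply Hs1; exists y; split; [lra | reflexivity]).
    generalize (Hm x y ltac:(lra) Hy1); intros.
    rewrite Rabs_pos_eq; lra.
Qed.

Lemma filterlim_within (f : R -> R) (D : R -> Prop) (c : R) :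
  continuous f c -> filterlim f (within D (locally c)) (locally (f c)).
Proof.
  intros H P HP. apply filter_le_within. exact (H P HP).
Qed.

Lemma mean_value (f df : R -> R) (a b : R) :
  a < b -> (forall x, a <= x <= b -> is_derive f x (df x)) ->
  exists c, a < c < b /\ f b - f a = df c * (b - a).
Proof.
  intros Hab Hf.
  destruct (MVT_cor2 f df a b Hab) as [c [Hc1 Hc2]].
  - intros c Hc. apply is_derive_Reals, Hf, Hc.
  - exists c. split; assumption.
Qed.

(** Monotonicity on (0, t) with the linear lower bound as a substitute for [f 0 >= 0]; [f] may be
    arbitrary at 0 itself, which is essential for functions involving [h]. *)
Lemma nonneg_of_derive_nonneg (f df : R -> R) (t d M : R) :
  0 < d ->
  (forall x, 0 < x < t -> is_derive f x (df x)) ->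
  (forall x, 0 < x < t -> 0 <= df x) ->
  (forall x, 0 < x < d -> - (M * x) <= f x) ->
  forall x, 0 < x < t -> 0 <= f x.
Proof.
  intros Hd Hf Hdf HM x Hx.
  apply Rnot_lt_le; intros Hneg.
  assert (HA : 0 < Rabs M + 1) by (generalize (Rabs_pos M); lra).
  (* So small that [M * y <= - f x / 2], whence [f y >= f x / 2 > f x], against monotonicity. The
     [+ 1] keeps the denominator positive when [M = 0]. *)
  set (y := Rmin (Rmin (x / 2) (d / 2)) (- f x / (2 * (Rabs M + 1)))).
  assert (Hq : 0 < - f x / (2 * (Rabs M + 1))) by (apply Rdiv_lt_0_compat; lra).
  assert (Hy0 : 0 < y) by (unfold y; repeat apply Rmin_glb_lt; lra).
  assert (Hy1 : y <= Rmin (x / 2) (d / 2)) by apply Rmin_l.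
  assert (Hy2 : y <= - f x / (2 * (Rabs M + 1))) by apply Rmin_r.
  generalize (Rmin_l (x / 2) (d / 2)) (Rmin_r (x / 2) (d / 2)); intros Hm1 Hm2.
  assert (HMy : M * y <= - f x / 2).
  { apply Rle_trans with ((Rabs M + 1) * y).
    - apply Rmult_le_compat_r; [lra | generalize (Rle_abs M); lra].
    - apply Rle_trans with ((Rabs M + 1) * (- f x / (2 * (Rabs M + 1)))).
      + apply Rmult_le_compat_l; lra.
      + right; field; lra. }
  assert (Hfy := HM y ltac:(lra)).
  destruct (mean_value f df y x) as [c [Hc He]]; [lra | intros; apply Hf; lra |].
  assert (0 <= df c * (x - y)) by (apply Rmult_le_pos; [apply Hdf | ]; lra).
  lra.
Qed.

Lemma pos_of_derive_pos (f df : R -> R) (t d M : R) :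
  0 < d ->
  (forall x, 0 < x < t -> is_derive f x (df x)) ->
  (forall x, 0 < x < t -> 0 < df x) ->
  (forall x, 0 < x < d -> - (M * x) <= f x) ->
  forall x, 0 < x < t -> 0 < f x.
Proof.
  intros Hd Hf Hdf HM x Hx.
  assert (H2 : 0 <= f (x / 2)).
  { apply (nonneg_of_derive_nonneg f df t d M); try assumption; try lra.
    intros; left; auto. }
  destruct (mean_value f df (x / 2) x) as [c [Hc He]]; [lra | intros; apply Hf; lra |].
  assert (0 < df c * (x - x / 2)) by (apply Rmult_lt_0_compat; [apply Hdf | ]; lra).
  lra.
Qed.

(** Serves at 0, the junction of the functions that are defined by cases there. *)
Lemma continuous_of_local_bound (f : R -> R) (c d M : R) :
  0 < d ->
  (forall x, c - d < x < c + d -> Rabs (f x - f c) <= M * Rabs (x - c)) ->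
  continuous f c.
Proof.
  intros Hd HM. apply filterlim_locally; intros e.
  assert (HA : 0 < Rabs M + 1) by (generalize (Rabs_pos M); lra).
  assert (He : 0 < Rmin d (e / (Rabs M + 1))).
  { apply Rmin_glb_lt; [assumption | apply Rdiv_lt_0_compat; [apply cond_pos | lra]]. }
  exists (mkposreal _ He); intros x Hx.
  change (Rabs (x - c) < Rmin d (e / (Rabs M + 1))) in Hx.
  change (Rabs (f x - f c) < e).
  assert (H1 := Rlt_le_trans _ _ _ Hx (Rmin_l _ _)).
  assert (H2 := Rlt_le_trans _ _ _ Hx (Rmin_r _ _)).
  apply Rabs_def2 in H1.
  eapply Rle_lt_trans; [apply HM; lra |].
  apply Rle_lt_trans with ((Rabs M + 1) * Rabs (x - c)).
  - apply Rmult_le_compat_r; [apply Rabs_pos | generalize (Rle_abs M); lra].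
  - replace (pos e) with ((Rabs M + 1) * (e / (Rabs M + 1))) by (field; lra).
    apply Rmult_lt_compat_l; assumption.
Qed.

Lemma continuous_on_of_continuous (J : R -> Prop) (f : R -> R) :
  (forall x, J x -> continuous f x) -> continuous_on J f.
Proof.
  intros H x Hx. apply filterlim_within, H, Hx.
Qed.

(** Left limits are unique; this carries identities valid below the free boundary to the boundary
    itself. *)
Lemma eq_of_eq_left (f1 f2 : R -> R) (s t : R) : s < t ->
  (forall x, s < x < t -> f1 x = f2 x) ->
  continuous f1 t -> continuous f2 t -> f1 t = f2 t.
Proof.
  intros Hst He H1 H2.
  apply (filterlim_locally_unique (F := at_left t) f1).
  - apply filterlim_within, H1.
  - apply filterlim_ext_loc with f2.
    + change (locally t (fun y => y < t -> f2 y = f1 y)).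
      generalize (locally_gt t s Hst). apply filter_imp. intros y Hy Hyt.
      symmetry; apply He; lra.
    + apply filterlim_within, H2.
Qed.

Lemma nonneg_of_exp_mult (t s : R) : 0 <= exp t * s -> 0 <= s.
Proof.
  intros H. apply Rmult_le_reg_l with (exp t); [apply exp_pos | lra].
Qed.

(** * The explicit solution psi of the first-order equation *)

Section ExplicitSolution.

Context (lambda beta gam : R).
Context (Hlambda : 0 < lambda) (Hbeta : 0 < beta) (Hgam : 0 < gam).

Let rho := lambda / gam.
Let r := beta / lambda.

Lemma rho_pos : 0 < lambda / gam.
Proof. apply Rdiv_lt_0_compat; assumption. Qed.

Lemma ratio_pos : 0 < beta / lambda.
Proof. apply Rdiv_lt_0_compat; assumption. Qed.

Definition dh (x : R) : R := lambda / gam / (x ^ 2 * (1 - x)).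

Lemma dh_pos (x : R) : 0 < x < 1 -> 0 < dh x.
Proof.
  intros Hx. unfold dh. apply Rdiv_lt_0_compat; [apply rho_pos |].
  apply Rmult_lt_0_compat; [apply pow_lt |]; lra.
Qed.

Lemma h_is_derive (x : R) : 0 < x < 1 -> is_derive (h lambda gam) x (dh x).
Proof.
  intros Hx. unfold h, dh. auto_derive.
  - repeat split; try lra. apply Rdiv_lt_0_compat; lra.
  - field; repeat split; lra.
Qed.

Lemma exp_h_is_derive (x : R) : 0 < x < 1 ->
  is_derive (fun y => exp (h lambda gam y)) x (dh x * exp (h lambda gam x)).
Proof.
  intros Hx. apply (is_derive_comp exp (h lambda gam) x).
  - apply is_derive_Reals, derivable_pt_lim_exp.
  - apply h_is_derive, Hx.
Qed.

(** On (0, 1/2) the logarithm in [h] is nonpositive, so [h x <= - rho / x]; the constant comes from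
    [exp t = exp (t / 2) ^ 2 >= (t / 2) ^ 2] with [t = rho / x]. *)
Lemma exp_h_le (x : R) : 0 < x < 1 / 2 ->
  exp (h lambda gam x) <= 4 / rho ^ 2 * x ^ 2.
Proof.
  intros Hx. generalize rho_pos; intros Hr; fold rho in Hr.
  assert (Hh : h lambda gam x <= - (rho / x)).
  { unfold h; fold rho.
    assert (ln (x / (1 - x)) <= 0).
    { rewrite <- ln_1. left; apply ln_increasing; [apply Rdiv_lt_0_compat; lra |].
      apply Rmult_lt_reg_r with (1 - x); [lra |]. unfold Rdiv.
      rewrite Rmult_assoc, Rinv_l; lra. }
    replace (- (rho / x)) with (rho * (0 - 1 / x)) by (field; lra).
    apply Rmult_le_compat_l; lra. }
  assert (H1 : (1 + rho / x / 2) <= exp (rho / x / 2)) by apply exp_ineq1_le.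
  assert (Hp : 0 < rho / x) by (apply Rdiv_lt_0_compat; lra).
  assert (H2 : (rho / x / 2) ^ 2 <= exp (rho / x)).
  { replace (rho / x) with (rho / x / 2 + rho / x / 2) at 2 by (field; lra).
    rewrite exp_plus. simpl. rewrite Rmult_1_r. apply Rmult_le_compat; lra. }
  apply Rle_trans with (exp (- (rho / x))).
  { destruct Hh as [Hh | Hh]; [left; apply exp_increasing, Hh | rewrite Hh; lra]. }
  rewrite exp_Ropp.
  replace (4 / rho ^ 2 * x ^ 2) with (/ ((rho / x / 2) ^ 2)) by (field; lra).
  apply Rinv_le_contravar; [apply pow_lt; lra | assumption].
Qed.

Definition integrand (y : R) : R := exp (h lambda gam y) / (y * (1 - y) ^ 2).

(** Continuous on the whole half-line below 1, so that the two-sided fundamental theorem of calculus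
    applies at 0 as well. *)
Definition integrand0 (y : R) : R := if Rlt_dec 0 y then integrand y else 0.

Lemma integrand0_nonneg (x : R) : x < 1 -> 0 <= integrand0 x.
Proof.
  intros Hx. unfold integrand0. destruct (Rlt_dec 0 x) as [H|H]; [| lra].
  unfold integrand. left; apply Rdiv_lt_0_compat; [apply exp_pos |].
  apply Rmult_lt_0_compat; [| apply pow_lt]; lra.
Qed.

Lemma integrand0_le (x : R) : x < 1 / 2 -> integrand0 x <= 16 / rho ^ 2 * Rabs x.
Proof.
  intros Hx. generalize rho_pos; intros Hr; fold rho in Hr.
  unfold integrand0. destruct (Rlt_dec 0 x) as [H|H].
  - rewrite Rabs_pos_eq; [| lra]. unfold integrand, Rdiv at 1.
    apply Rle_trans with (4 / rho ^ 2 * x ^ 2 * (4 / x)).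
    + apply Rmult_le_compat.
      * left; apply exp_pos.
      * left; apply Rinv_0_lt_compat, Rmult_lt_0_compat; [| apply pow_lt]; lra.
      * apply exp_h_le; lra.
      * replace (4 / x) with (/ (x * (1 / 2) ^ 2)) by (field; lra).
        apply Rinv_le_contravar.
        -- apply Rmult_lt_0_compat; [lra | apply pow_lt; lra].
        -- apply Rmult_le_compat_l; [lra |]. apply pow_incr; lra.
    + right; field; lra.
  - apply Rmult_le_pos; [| apply Rabs_pos].
    left; apply Rdiv_lt_0_compat; [lra | apply pow_lt; lra].
Qed.

Lemma integrand0_continuous (x : R) : x < 1 -> continuous integrand0 x.
Proof.
  intros Hx. destruct (Rtotal_order x 0) as [H | [H | H]].
  - apply continuous_ext_loc with (fun _ => 0); [| apply continuous_const].
    apply filter_imp with (2 := locally_lt x 0 H). intros y Hy.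
    unfold integrand0; destruct (Rlt_dec 0 y); lra.
  - subst x. apply (continuous_of_local_bound integrand0 0 (1 / 2) (16 / rho ^ 2)); [lra |].
    intros x Hx'. replace (integrand0 0) with 0.
    + rewrite !Rminus_0_r, (Rabs_pos_eq (integrand0 x)).
      * apply integrand0_le; lra.
      * apply integrand0_nonneg; lra.
    + unfold integrand0; destruct (Rlt_dec 0 0); lra.
  - apply continuous_ext_loc with integrand.
    + apply filter_imp with (2 := locally_gt x 0 H). intros y Hy.
      unfold integrand0; destruct (Rlt_dec 0 y); lra.
    + assert (Hp : 0 < x * (1 - x) ^ 2) by (apply Rmult_lt_0_compat; [| apply pow_lt]; lra).
      apply (ex_derive_continuous integrand). unfold integrand.
      apply (ex_derive_div (fun y => exp (h lambda gam y)) (fun y => y * (1 - y) ^ 2)).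
      * eexists; apply exp_h_is_derive; lra.
      * auto_derive; trivial.
      * lra.
Qed.

Definition I0 (x : R) : R := RInt integrand0 0 x.

Lemma I0_is_derive (x : R) : x < 1 -> is_derive I0 x (integrand0 x).
Proof.
  intros Hx. apply (is_derive_RInt integrand0 I0 0 x).
  - apply filter_imp with (2 := locally_lt x 1 Hx). intros y Hy.
    apply (RInt_correct integrand0 0 y), ex_RInt_continuous. intros z Hz.
    apply integrand0_continuous.
    apply Rle_lt_trans with (1 := proj2 Hz). apply Rmax_lub_lt; lra.
  - apply integrand0_continuous, Hx.
Qed.

Lemma I0_0 : I0 0 = 0.
Proof. unfold I0. apply (RInt_point 0 integrand0). Qed.

Lemma I0_nonneg (x : R) : 0 < x < 1 -> 0 <= I0 x.
Proof.
  intros Hx.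
  destruct (mean_value I0 integrand0 0 x) as [c [Hc He]]; [lra | intros; apply I0_is_derive; lra |].
  rewrite I0_0 in He.
  assert (0 <= integrand0 c * (x - 0)).
  { apply Rmult_le_pos; [apply integrand0_nonneg |]; lra. }
  lra.
Qed.

Lemma I0_le (x : R) : 0 < x < 1 / 2 -> I0 x <= 16 / rho ^ 2 * x.
Proof.
  intros Hx. generalize rho_pos; intros Hr; fold rho in Hr.
  destruct (mean_value I0 integrand0 0 x) as [c [Hc He]]; [lra | intros; apply I0_is_derive; lra |].
  rewrite I0_0, !Rminus_0_r in He. rewrite He.
  apply Rmult_le_compat_r; [lra |].
  apply Rle_trans with (1 := integrand0_le c ltac:(lra)).
  rewrite Rabs_pos_eq; [| lra].
  rewrite <- (Rmult_1_r (16 / rho ^ 2)) at 2. apply Rmult_le_compat_l; [| lra].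
  left; apply Rdiv_lt_0_compat; [lra | apply pow_lt; lra].
Qed.

Notation psi := (psi lambda beta gam).
Notation Psi := (Psi lambda beta gam).
Notation h := (h lambda gam).

Lemma psi_nonpos_arg (x : R) : x <= 0 -> psi x = 0.
Proof. intros Hx. unfold Defs.psi. destruct (Rlt_dec 0 x); lra. Qed.

Lemma psi_eq (x : R) : 0 < x -> psi x = - (rho * r) * exp (- h x) * I0 x.
Proof.
  intros Hx. unfold Defs.psi. destruct (Rlt_dec 0 x) as [H | H]; [| lra].
  assert (He : I0 x = RInt integrand 0 x).
  { apply RInt_ext. intros y. rewrite Rmin_left, Rmax_right by lra. intros Hy.
    unfold integrand0. destruct (Rlt_dec 0 y); lra. }
  rewrite He. unfold integrand, rho, r.
  replace (lambda / gam * (beta / lambda)) with (beta / gam) by (field; lra).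
  reflexivity.
Qed.

Lemma exp_h_psi (x : R) : 0 < x -> exp (h x) * psi x = - (rho * r) * I0 x.
Proof.
  intros Hx. rewrite psi_eq by assumption. rewrite exp_Ropp.
  field. apply Rgt_not_eq, exp_pos.
Qed.

(** The equation [L f = - beta x] solved for the second derivative, with [psi] as the first. *)
Definition dpsi (x : R) : R := - dh x * (r * x / (1 - x) + psi x).

Lemma psi_is_derive (x : R) : 0 < x < 1 -> is_derive psi x (dpsi x).
Proof.
  intros Hx.
  apply is_derive_ext_loc with (fun y => - (rho * r) * (exp (- h y) * I0 y)).
  { apply filter_imp with (2 := locally_gt x 0 (proj1 Hx)). intros y Hy.
    rewrite psi_eq by assumption. real_eq. ring. }
  assert (H1 : is_derive (fun y => exp (- h y)) x (- dh x * exp (- h x))).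
  { apply (is_derive_comp exp (fun y => - h y) x).
    - apply is_derive_Reals, derivable_pt_lim_exp.
    - apply (is_derive_opp h x (dh x)), h_is_derive, Hx. }
  assert (H2 := I0_is_derive x ltac:(lra)).
  assert (H3 := is_derive_mult _ _ x _ _ H1 H2 Rmult_comm).
  assert (H4 := is_derive_scal _ x (- (rho * r)) _ H3).
  apply (is_derive_eq _ _ _ _ H4).
  unfold dpsi. rewrite psi_eq by lra.
  unfold plus, mult; simpl. unfold integrand0, integrand.
  destruct (Rlt_dec 0 x) as [H | H]; [| lra].
  rewrite exp_Ropp. unfold dh, rho, r. field.
  repeat split; try lra. apply Rgt_not_eq, exp_pos.
Qed.

(* With [phi = c x^2 / (1 - x)],
   [(exp h (r x / (1 - x) + psi - phi))' = exp h (r - c (rho + 2 x - x^2)) / (1 - x)^2],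
   so the sign of [r - c (rho + 2 x - x^2)] decides which side of [phi] the
   sum [r x / (1 - x) + psi] lies on. *)
Definition gap (c x : R) : R :=
  exp (h x) * (r * x / (1 - x) - c * x ^ 2 / (1 - x)) - rho * r * I0 x.

Lemma gap_eq (c x : R) : 0 < x ->
  gap c x = exp (h x) * (r * x / (1 - x) + psi x - c * x ^ 2 / (1 - x)).
Proof.
  intros Hx. unfold gap.
  replace (rho * r * I0 x) with (- (exp (h x) * psi x)) by (rewrite exp_h_psi by lra; ring).
  ring.
Qed.

Lemma gap_is_derive (c x : R) : 0 < x < 1 ->
  is_derive (gap c) x (exp (h x) * ((r - c * (rho + 2 * x - x ^ 2)) / (1 - x) ^ 2)).
Proof.
  intros Hx.
  assert (H1 := exp_h_is_derive x Hx).
  assert (H2 : is_derive (fun x => r * x / (1 - x) - c * x ^ 2 / (1 - x)) x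
     ((r - c * (2 * x - x ^ 2)) / (1 - x) ^ 2)).
  { auto_derive; [repeat split; lra | field; lra]. }
  assert (H3 := is_derive_mult _ _ x _ _ H1 H2 Rmult_comm).
  assert (H4 := is_derive_scal _ x (rho * r) _ (I0_is_derive x ltac:(lra))).
  assert (H5 := is_derive_minus _ _ x _ _ H3 H4).
  apply (is_derive_eq _ _ _ _ H5).
  unfold minus, plus, opp, mult; simpl. unfold integrand0, integrand.
  destruct (Rlt_dec 0 x) as [H | H]; [| lra].
  unfold dh; fold rho. field. lra.
Qed.

Lemma exp_h_le_lin (x : R) : 0 < x < 1 / 2 -> exp (h x) <= 4 / rho ^ 2 * x.
Proof.
  intros Hx. generalize rho_pos; intros Hr; fold rho in Hr.
  apply Rle_trans with (1 := exp_h_le x Hx). apply Rmult_le_compat_l.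
  - left; apply Rdiv_lt_0_compat; [lra | apply pow_lt; lra].
  - simpl. rewrite Rmult_1_r. rewrite <- (Rmult_1_r x) at 3. apply Rmult_le_compat_l; lra.
Qed.

(** Both terms of [gap] are O(x), by [exp_h_le_lin] and [I0_le]. This is the condition at 0 required
    by [nonneg_of_derive_nonneg]. *)
Lemma gap_bound (c : R) : exists M,
  forall x, 0 < x < 1 / 2 -> Rabs (gap c x) <= M * x.
Proof.
  generalize rho_pos ratio_pos; intros Hr Hr'; fold rho in Hr; fold r in Hr'.
  exists (4 / rho ^ 2 * (2 * r + 2 * Rabs c) + rho * r * (16 / rho ^ 2)).
  intros x Hx. unfold gap.
  eapply Rle_trans; [apply Rabs_triang |]. rewrite Rabs_Ropp, !Rabs_mult.
  rewrite (Rabs_pos_eq (exp (h x))) by (left; apply exp_pos).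
  rewrite (Rabs_pos_eq rho), (Rabs_pos_eq r) by lra.
  rewrite (Rabs_pos_eq (I0 x)) by (apply I0_nonneg; lra).
  rewrite Rmult_plus_distr_r. apply Rplus_le_compat.
  - replace (4 / rho ^ 2 * (2 * r + 2 * Rabs c) * x)
      with ((4 / rho ^ 2 * x) * (2 * r + 2 * Rabs c)) by ring.
    apply Rmult_le_compat.
    + left; apply exp_pos.
    + apply Rabs_pos.
    + apply exp_h_le_lin, Hx.
    + assert (Hi : 0 < / (1 - x) <= 2).
      { split; [apply Rinv_0_lt_compat; lra |].
        replace 2 with (/ (1 / 2)) by field. apply Rinv_le_contravar; lra. }
      assert (Hq : 0 <= x / (1 - x) <= 2).
      { unfold Rdiv. split; [apply Rmult_le_pos; lra |].
        replace 2 with (1 * 2) by ring. apply Rmult_le_compat; lra. }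
      replace (r * x / (1 - x) - c * x ^ 2 / (1 - x))
        with ((x / (1 - x)) * (r - c * x)) by (field; lra).
      rewrite Rabs_mult, (Rabs_pos_eq (x / (1 - x))) by lra.
      replace (2 * r + 2 * Rabs c) with (2 * (r + Rabs c)) by ring.
      apply Rmult_le_compat; [lra | apply Rabs_pos | lra |].
      eapply Rle_trans; [apply Rabs_triang |].
      rewrite (Rabs_pos_eq r), Rabs_Ropp, Rabs_mult, (Rabs_pos_eq x) by lra.
      apply Rplus_le_compat_l. rewrite <- (Rmult_1_r (Rabs c)) at 2.
      apply Rmult_le_compat_l; [apply Rabs_pos | lra].
  - rewrite !Rmult_assoc. apply Rmult_le_compat_l; [lra |].
    apply Rmult_le_compat_l; [lra |].
    apply I0_le, Hx.
Qed.

(** For [y <= x] one has [rho + 2 y - y ^ 2 <= rho + 2 x], so with [c = r / (rho + 2 x)] the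
    function [gap c] does not decrease on (0, x). *)
Lemma psi_gap_lower (x : R) : 0 < x < 1 ->
  r / (rho + 2 * x) * x ^ 2 / (1 - x) <= r * x / (1 - x) + psi x.
Proof.
  intros Hx. generalize rho_pos ratio_pos; intros Hr Hr'; fold rho in Hr; fold r in Hr'.
  set (c := r / (rho + 2 * x)).
  assert (Hc : 0 < c) by (apply Rdiv_lt_0_compat; lra).
  destruct (gap_bound c) as [M HM].
  (* [c] depends on the endpoint [x], which is reached only by continuity. *)
  assert (Hy : forall y, 0 < y < x -> 0 <= gap c y).
  { apply (nonneg_of_derive_nonneg (gap c) _ x (1 / 2) M) with
      (2 := fun y (Hy : 0 < y < x) => gap_is_derive c y ltac:(lra)); [lra | |].
    - intros y Hy. apply Rmult_le_pos; [left; apply exp_pos |].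
      apply Rdiv_le_0_compat; [| apply pow_lt; lra].
      assert (c * (rho + 2 * y - y ^ 2) <= c * (rho + 2 * x)).
      { apply Rmult_le_compat_l; [lra |]. generalize (pow2_ge_0 y); lra. }
      assert (c * (rho + 2 * x) = r) by (unfold c; field; lra). lra.
    - intros y Hy. generalize (HM y Hy); intros H.
      apply Rabs_le_between in H. lra. }
  assert (Hx0 : 0 <= gap c x).
  { apply Rnot_lt_le; intros Hneg.
    assert (Hcont := continuous_of_is_derive _ _ _ (gap_is_derive c x Hx)).
    assert (Hloc : locally x (fun y => gap c y < 0)).
    { apply (Hcont (fun z => z < 0)). apply (open_lt 0 (gap c x) Hneg). }
    destruct (filter_and _ _ Hloc (locally_gt x 0 ltac:(lra))) as [d Hd].
    set (y := x - Rmin (d / 2) (x / 2)).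
    generalize (Rmin_l (d / 2) (x / 2)) (Rmin_r (d / 2) (x / 2)) (cond_pos d); intros.
    assert (0 < Rmin (d / 2) (x / 2)) by (apply Rmin_glb_lt; lra).
    destruct (Hd y) as [Hd1 Hd2].
    { change (Rabs (y - x) < d). unfold y.
      rewrite Rabs_left; lra. }
    assert (H4 := Hy y ltac:(unfold y in *; lra)). lra. }
  rewrite gap_eq in Hx0 by lra.
  apply (nonneg_of_exp_mult (h x)) in Hx0. fold c. lra.
Qed.

(** Here [c = r / rho] is the least constant for which [gap c] is nonincreasing on all of (0, 1). *)
Lemma psi_gap_upper (x : R) : 0 < x < 1 ->
  r * x / (1 - x) + psi x <= r / rho * x ^ 2 / (1 - x).
Proof.
  intros Hx. generalize rho_pos ratio_pos; intros Hr Hr'; fold rho in Hr; fold r in Hr'.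
  destruct (gap_bound (r / rho)) as [M HM].
  assert (H : 0 <= - gap (r / rho) x).
  { apply (nonneg_of_derive_nonneg (fun y => - gap (r / rho) y) _ 1 (1 / 2) M) with
      (2 := fun y (Hy : 0 < y < 1) => is_derive_opp _ y _ (gap_is_derive (r / rho) y ltac:(lra))); [lra | | | lra].
    - intros y Hy.
      change (0 <= - (exp (h y) * ((r - r / rho * (rho + 2 * y - y ^ 2)) / (1 - y) ^ 2))).
      rewrite Ropp_mult_distr_r. apply Rmult_le_pos; [left; apply exp_pos |].
      unfold Rdiv at 1. rewrite Ropp_mult_distr_l.
      apply Rdiv_le_0_compat; [| apply pow_lt; lra].
      replace (- (r - r / rho * (rho + 2 * y - y ^ 2))) with (r / rho * (y * (2 - y))) by (field; lra).
      apply Rmult_le_pos; [left; apply Rdiv_lt_0_compat; lra | apply Rmult_le_pos; lra].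
    - intros y Hy. generalize (HM y Hy); intros H.
      apply Rabs_le_between in H. lra. }
  rewrite gap_eq in H by lra.
  rewrite Ropp_mult_distr_r in H.
  apply (nonneg_of_exp_mult (h x)) in H. lra.
Qed.

(** Together with [dpsi_upper] this forces psi' to tend to [- r] at 0. The upper bound also makes
    [Psi] strictly concave and gives the growth of psi' at 1. *)
Lemma dpsi_lower (x : R) : 0 < x < 1 -> - r / (1 - x) ^ 2 <= dpsi x.
Proof.
  intros Hx. generalize rho_pos; intros Hr; fold rho in Hr.
  generalize (psi_gap_upper x Hx) (dh_pos x Hx); intros H Hd.
  unfold dpsi.
  replace (- r / (1 - x) ^ 2) with (- dh x * (r / rho * x ^ 2 / (1 - x))).
  - rewrite !Ropp_mult_distr_l_reverse. apply Ropp_le_contravar, Rmult_le_compat_l; lra.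
  - unfold dh; fold rho. field; lra.
Qed.

Lemma dpsi_upper (x : R) : 0 < x < 1 ->
  dpsi x <= - (rho * r / (rho + 2 * x) / (1 - x) ^ 2).
Proof.
  intros Hx. generalize rho_pos; intros Hr; fold rho in Hr.
  generalize (psi_gap_lower x Hx) (dh_pos x Hx); intros H Hd.
  unfold dpsi.
  replace (rho * r / (rho + 2 * x) / (1 - x) ^ 2)
    with (dh x * (r / (rho + 2 * x) * x ^ 2 / (1 - x))).
  - rewrite !Ropp_mult_distr_l_reverse. apply Ropp_le_contravar, Rmult_le_compat_l; lra.
  - unfold dh; fold rho. field; lra.
Qed.

Lemma dpsi_neg (x : R) : 0 < x < 1 -> dpsi x < 0.
Proof.
  intros Hx. apply Rle_lt_trans with (1 := dpsi_upper x Hx).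
  generalize rho_pos ratio_pos; intros Hr Hr'; fold rho in Hr; fold r in Hr'.
  apply Ropp_lt_gt_0_contravar. repeat apply Rdiv_lt_0_compat; try lra.
  - apply Rmult_lt_0_compat; lra.
  - apply pow_lt; lra.
Qed.

Lemma psi_le_0 (x : R) : x < 1 -> psi x <= 0.
Proof.
  intros Hx. generalize rho_pos ratio_pos; intros Hr Hr'; fold rho in Hr; fold r in Hr'.
  destruct (Rle_lt_dec x 0) as [H | H]; [rewrite psi_nonpos_arg; lra |].
  rewrite psi_eq by assumption.
  rewrite !Ropp_mult_distr_l_reverse.
  assert (0 <= rho * r * exp (- h x) * I0 x); [| lra].
  apply Rmult_le_pos; [| apply I0_nonneg; lra].
  apply Rmult_le_pos; [apply Rmult_le_pos; lra | left; apply exp_pos].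
Qed.

Lemma psi_continuous (x : R) : x < 1 -> continuous psi x.
Proof.
  intros Hx. generalize rho_pos ratio_pos; intros Hr Hr'; fold rho in Hr; fold r in Hr'.
  destruct (Rtotal_order x 0) as [H | [H | H]].
  - apply continuous_ext_loc with (fun _ => 0); [| apply continuous_const].
    apply filter_imp with (2 := locally_lt x 0 H). intros y Hy.
    rewrite psi_nonpos_arg; lra.
  - subst x. apply (continuous_of_local_bound psi 0 (1 / 2) (2 * r)); [lra |].
    intros x Hx'. rewrite (psi_nonpos_arg 0), !Rminus_0_r by lra.
    destruct (Rle_lt_dec x 0) as [Hx0 | Hx0].
    + rewrite psi_nonpos_arg, Rabs_R0 by lra. apply Rmult_le_pos; [lra | apply Rabs_pos].
    + rewrite (Rabs_pos_eq x), Rabs_left1 by (try apply psi_le_0; lra).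
      (* Its left side is nonnegative, so [- psi x <= r x / (1 - x) <= 2 r x]. *)
      assert (H := psi_gap_lower x ltac:(lra)).
      assert (0 <= r / (rho + 2 * x) * x ^ 2 / (1 - x)).
      { apply Rdiv_le_0_compat; [| lra]. apply Rmult_le_pos; [| apply pow2_ge_0].
        left; apply Rdiv_lt_0_compat; lra. }
      apply Rle_trans with (r * x / (1 - x)); [lra |].
      unfold Rdiv. replace (2 * r * x) with (r * x * 2) by ring.
      apply Rmult_le_compat_l; [apply Rmult_le_pos; lra |].
      replace 2 with (/ (1 / 2)) by field. apply Rinv_le_contravar; lra.
  - apply (continuous_of_is_derive _ _ _ (psi_is_derive x ltac:(lra))).
Qed.

Lemma Psi_is_derive (x : R) : x < 1 -> is_derive Psi x (psi x).
Proof.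
  intros Hx. apply (is_derive_RInt psi Psi 0 x).
  - apply filter_imp with (2 := locally_lt x 1 Hx). intros y Hy.
    apply (RInt_correct psi 0 y), ex_RInt_continuous. intros z Hz.
    apply psi_continuous.
    apply Rle_lt_trans with (1 := proj2 Hz). apply Rmax_lub_lt; lra.
  - apply psi_continuous, Hx.
Qed.

Lemma Psi_0 : Psi 0 = 0.
Proof. apply (RInt_point 0 psi). Qed.

Lemma psi_decreasing (x y : R) : 0 < x < y -> y < 1 -> psi y < psi x.
Proof.
  intros Hx Hy.
  destruct (mean_value psi dpsi x y) as [c [Hc He]]; [lra | intros; apply psi_is_derive; lra |].
  assert (0 < (- dpsi c) * (y - x)); [| lra].
  apply Rmult_lt_0_compat; [generalize (dpsi_neg c ltac:(lra)) |]; lra.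
Qed.

Lemma psi_nonincreasing (x y : R) : x <= y -> y < 1 -> psi y <= psi x.
Proof.
  intros Hxy Hy. destruct (Rle_lt_dec x 0) as [Hx | Hx].
  - rewrite (psi_nonpos_arg x Hx). apply psi_le_0, Hy.
  - destruct Hxy as [Hxy | <-]; [left; apply psi_decreasing; lra | lra].
Qed.

Lemma dpsi_continuous (x : R) : 0 < x < 1 -> continuous dpsi x.
Proof.
  intros Hx. unfold dpsi.
  apply (continuous_mult (fun x => - dh x) (fun x => r * x / (1 - x) + psi x)).
  - apply (ex_derive_continuous (fun x => - dh x)).
    unfold dh. auto_derive. assert (0 < x * (x * 1) * (1 - x)); [| lra].
    repeat apply Rmult_lt_0_compat; lra.
  - apply (continuous_plus (fun x => r * x / (1 - x)) psi).
    + apply (ex_derive_continuous (fun x => r * x / (1 - x))). auto_derive. lra.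
    + apply psi_continuous; lra.
Qed.

Lemma Psi_nonincreasing (x y : R) : x <= y -> y < 1 -> Psi y <= Psi x.
Proof.
  intros [Hxy | <-] Hy; [| lra].
  destruct (mean_value Psi psi x y Hxy) as [c [Hc He]].
  { intros z Hz. apply Psi_is_derive; lra. }
  assert (0 <= (- psi c) * (y - x)); [| lra].
  apply Rmult_le_pos; [| lra].
  generalize (psi_le_0 c ltac:(lra)). lra.
Qed.

Lemma Psi_le_0 (x : R) : 0 <= x < 1 -> Psi x <= 0.
Proof.
  intros Hx. rewrite <- (Psi_0). apply Psi_nonincreasing; lra.
Qed.

(** * The operator A and the system for (C, a) *)

Context (eps : R) (Heps : 0 <= eps < 1).

(** Both the denominator of [g] and the weight of [v (g x)] in [opA]; this coincidence makes [opA] a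
    perspective transformation. *)
Definition gden (x : R) : R := 1 - (1 - eps) * x.

Lemma gden_pos (x : R) : x < 1 -> 0 < gden x.
Proof. intros Hx. unfold gden. nra. Qed.

Lemma gden_mul_g (x : R) : x < 1 -> gden x * g eps x = eps * x.
Proof.
  intros Hx. generalize (gden_pos x Hx). unfold g, gden. intros H. field. lra.
Qed.

Lemma one_minus_g (x : R) : x < 1 -> 1 - g eps x = (1 - x) / gden x.
Proof.
  intros Hx. generalize (gden_pos x Hx). unfold g, gden. intros H. field. lra.
Qed.

Lemma g_lt_1 (x : R) : x < 1 -> g eps x < 1.
Proof.
  intros Hx. assert (0 < 1 - g eps x); [| lra].
  rewrite one_minus_g by assumption. apply Rdiv_lt_0_compat; [lra | apply gden_pos, Hx].
Qed.

Lemma g_nonneg (x : R) : 0 <= x < 1 -> 0 <= g eps x.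
Proof.
  intros Hx. unfold g. apply Rdiv_le_0_compat; [nra | apply (gden_pos x); lra].
Qed.

Lemma g_pos (x : R) : 0 < eps -> 0 < x < 1 -> 0 < g eps x.
Proof.
  intros He Hx. unfold g. apply Rdiv_lt_0_compat; [nra | apply (gden_pos x); lra].
Qed.

Lemma sub_g (x : R) : x < 1 -> x - g eps x = (1 - eps) * x * (1 - x) / gden x.
Proof.
  intros Hx. generalize (gden_pos x Hx). unfold g, gden. intros H. field. lra.
Qed.

Lemma g_lt (x : R) : 0 < x < 1 -> g eps x < x.
Proof.
  intros Hx. assert (0 < x - g eps x); [| lra]. rewrite sub_g by lra.
  apply Rdiv_lt_0_compat; [| apply gden_pos; lra].
  repeat apply Rmult_lt_0_compat; lra.
Qed.

Lemma g_sub_g (x y : R) : x < 1 -> y < 1 ->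
  g eps y - g eps x = eps * (y - x) / (gden x * gden y).
Proof.
  intros Hx Hy. generalize (gden_pos x Hx) (gden_pos y Hy). unfold g, gden.
  intros H1 H2. field. lra.
Qed.

Lemma g_le (x y : R) : x <= y -> y < 1 -> g eps x <= g eps y.
Proof.
  intros Hxy Hy. assert (0 <= g eps y - g eps x); [| lra]. rewrite g_sub_g by lra.
  apply Rdiv_le_0_compat; [nra |].
  apply Rmult_lt_0_compat; apply gden_pos; lra.
Qed.

Lemma g_is_derive (x : R) : x < 1 -> is_derive (g eps) x (eps / gden x ^ 2).
Proof.
  intros Hx. generalize (gden_pos x Hx). unfold g, gden. intros H.
  auto_derive; [lra | field; lra].
Qed.

Lemma g_continuous (x : R) : x < 1 -> continuous (g eps) x.
Proof. intros Hx. apply (continuous_of_is_derive _ _ _ (g_is_derive x Hx)). Qed.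

Lemma g_eps_0 (x : R) : eps = 0 -> g eps x = 0.
Proof. intros ->. unfold g, Rdiv. ring. Qed.

(* For [eps = 0] the map [g] is constant, so nothing is required of [f]. *)
Lemma comp_g_is_derive (f : R -> R) (x d : R) : x < 1 ->
  (0 < eps -> is_derive f (g eps x) d) ->
  is_derive (fun y => f (g eps y)) x (eps / gden x ^ 2 * d).
Proof.
  intros Hx Hf. destruct (proj1 Heps) as [He | He].
  - apply (is_derive_comp f (g eps) x); [apply Hf, He | apply g_is_derive, Hx].
  - apply is_derive_ext with (fun _ => f 0).
    + intros y. rewrite g_eps_0 by lra. reflexivity.
    + apply (is_derive_eq _ _ 0); [apply (is_derive_const (f 0) x) |].
      rewrite <- He. unfold Rdiv. ring.
Qed.

Lemma opA_is_derive (f : R -> R) (x d : R) : x < 1 ->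
  (0 < eps -> is_derive f (g eps x) d) ->
  is_derive (opA eps f) x (- (1 - eps) * f (g eps x) + eps / gden x * d).
Proof.
  intros Hx Hf. assert (Hd := gden_pos x Hx).
  assert (H1 : is_derive gden x (- (1 - eps))).
  { unfold gden. auto_derive; [trivial | ring]. }
  assert (H2 := is_derive_mult _ _ x _ _ H1 (comp_g_is_derive f x d Hx Hf) Rmult_comm).
  assert (H3 := is_derive_plus _ _ x _ _ (is_derive_const 1 x) H2).
  apply (is_derive_eq _ _ _ _ H3). unfold plus, mult, zero; simpl. field. lra.
Qed.

(** The two terms containing [df (g x)] cancel, as always for a perspective; only the second
    derivative survives, with a nonnegative factor. *)
Lemma dopA_is_derive (f df : R -> R) (x d : R) : x < 1 ->
  (0 < eps -> is_derive f (g eps x) (df (g eps x))) ->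
  (0 < eps -> is_derive df (g eps x) d) ->
  is_derive (fun y => - (1 - eps) * f (g eps y) + eps / gden y * df (g eps y)) x
    (eps ^ 2 / gden x ^ 3 * d).
Proof.
  intros Hx Hf Hdf. assert (Hd := gden_pos x Hx).
  assert (H0 : is_derive (fun y => eps / gden y) x (eps * (1 - eps) / gden x ^ 2)).
  { unfold gden in *. auto_derive; [lra | field; lra]. }
  assert (H1 := is_derive_scal _ x (- (1 - eps)) _ (comp_g_is_derive f x _ Hx Hf)).
  assert (H2 := is_derive_mult _ _ x _ _ H0 (comp_g_is_derive df x d Hx Hdf) Rmult_comm).
  assert (H3 := is_derive_plus _ _ x _ _ H1 H2).
  apply (is_derive_eq _ _ _ _ H3). unfold plus, mult; simpl. field. lra.
Qed.

(** * Strict convexity of N = A Psi - Psi *)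

Definition excess (x : R) : R := opA eps Psi x - Psi x.

Definition dexcess (x : R) : R :=
  - (1 - eps) * Psi (g eps x) + eps / gden x * psi (g eps x) - psi x.

Definition tangent_at_1 (q : R) : R := Psi q + (1 - q) * psi q.

Definition forcing (x : R) : R :=
  (1 - eps) * (r * x / (1 - x) - tangent_at_1 (g eps x)).

Lemma excess_is_derive (x : R) : x < 1 -> is_derive excess x (dexcess x).
Proof.
  intros Hx.
  apply (is_derive_minus (opA eps Psi) Psi x).
  - apply opA_is_derive; [exact Hx |]. intros _. apply Psi_is_derive; try assumption.
    apply g_lt_1, Hx.
  - apply Psi_is_derive; assumption.
Qed.

(* [L (A V) - L V = lambda (1 - x) forcing] for [V = Psi], divided by [gam x^2 (1 - x)^2]. *)
Lemma dexcess_is_derive (x : R) : 0 < x < 1 ->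
  is_derive dexcess x (dh x * (forcing x - dexcess x)).
Proof.
  intros Hx. assert (Hd := gden_pos x ltac:(lra)). assert (Hg := g_lt_1 x ltac:(lra)).
  generalize rho_pos; intros Hr; fold rho in Hr.
  assert (H1 := dopA_is_derive Psi psi x (dpsi (g eps x)) ltac:(lra)
    (fun _ => Psi_is_derive _ Hg)
    (fun He => psi_is_derive _ (conj (g_pos x He Hx) Hg))).
  assert (H2 := is_derive_minus _ _ x _ _ H1 (psi_is_derive x Hx)).
  apply (is_derive_eq _ _ _ _ H2).
  unfold minus, plus, opp; simpl.
  unfold forcing, dexcess, tangent_at_1, dpsi. fold r.
  destruct (proj1 Heps) as [He | He].
  - assert (Hg0 := g_pos x He Hx).
    rewrite one_minus_g by lra. unfold dh. rewrite one_minus_g by lra. fold rho.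
    set (p := psi (g eps x)). set (P := Psi (g eps x)).
    replace (g eps x) with (eps * x / gden x).
    + unfold gden in *. field. lra.
    + reflexivity.
  - rewrite g_eps_0, Psi_0, (psi_nonpos_arg 0) by lra. rewrite <- He. unfold Rdiv. ring.
Qed.

Lemma tangent_comp_g_is_derive (x : R) : 0 < x < 1 ->
  is_derive (fun y => tangent_at_1 (g eps y)) x
    (eps / gden x ^ 2 * ((1 - g eps x) * dpsi (g eps x))).
Proof.
  intros Hx. assert (Hg := g_lt_1 x ltac:(lra)).
  apply comp_g_is_derive; [lra |]. intros He. assert (Hg0 := g_pos x He Hx).
  set (q := g eps x) in *. unfold tangent_at_1.
  assert (H1 : is_derive (fun q => 1 - q) q (- 1)) by (auto_derive; [trivial | ring]).
  assert (H2 := is_derive_mult _ _ q _ _ H1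
    (psi_is_derive q (conj Hg0 Hg)) Rmult_comm).
  assert (H3 := is_derive_plus _ _ q _ _ (Psi_is_derive q Hg) H2).
  apply (is_derive_eq _ _ _ _ H3). unfold plus, mult; simpl. ring.
Qed.

Definition dforcing (x : R) : R :=
  (1 - eps) * (r / (1 - x) ^ 2 - eps / gden x ^ 2 * ((1 - g eps x) * dpsi (g eps x))).

Lemma forcing_is_derive (x : R) : 0 < x < 1 -> is_derive forcing x (dforcing x).
Proof.
  intros Hx.
  assert (H1 : is_derive (fun x => r * x / (1 - x)) x (r / (1 - x) ^ 2)).
  { auto_derive; [lra | field; lra]. }
  assert (H2 := is_derive_minus _ _ x _ _ H1 (tangent_comp_g_is_derive x Hx)).
  apply (is_derive_scal _ x (1 - eps) _ H2).
Qed.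

Lemma dforcing_pos (x : R) : 0 < x < 1 -> 0 < dforcing x.
Proof.
  intros Hx. assert (Hd := gden_pos x ltac:(lra)). assert (Hg := g_lt_1 x ltac:(lra)).
  unfold dforcing. apply Rmult_lt_0_compat; [lra |].
  assert (0 < r / (1 - x) ^ 2).
  { apply Rdiv_lt_0_compat; [apply ratio_pos | apply pow_lt; lra]. }
  assert (0 <= eps / gden x ^ 2 * ((1 - g eps x) * - dpsi (g eps x))); [| lra].
  destruct (proj1 Heps) as [He | He].
  - apply Rmult_le_pos.
    + apply Rdiv_le_0_compat; [lra | apply pow_lt; lra].
    + apply Rmult_le_pos; [lra |].
      assert (Hn := dpsi_neg  (g eps x) (conj (g_pos x He Hx) Hg)). lra.
  - rewrite <- He. unfold Rdiv. lra.
Qed.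

(* [exp h (forcing - dexcess)] has derivative [exp h * dforcing > 0] and vanishes at [0]. *)
Lemma dexcess_lt_forcing (x : R) : 0 < x < 1 -> dexcess x < forcing x.
Proof.
  intros Hx.
  generalize rho_pos; intros Hr; fold rho in Hr.
  generalize ratio_pos; intros Hr'; fold r in Hr'.
  (* [Psi] and [psi] are nonpositive and nonincreasing, so [B] bounds [dexcess] from above on (0,
     1/2). As [forcing] is nonnegative there, [exp h (forcing - dexcess)] is at least [- exp h B],
     which is O(x). *)
  set (B := - Psi (1 / 2) - psi (1 / 2)).
  assert (HK : 0 < exp (h x) * (forcing x - dexcess x)).
  { apply (pos_of_derive_pos (fun y => exp (h y) * (forcing y - dexcess y))
      (fun y => exp (h y) * dforcing y) 1 (1 / 2) (4 / rho ^ 2 * B)); [lra | | | | lra].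
    - intros y Hy.
      assert (H1 := exp_h_is_derive y Hy).
      assert (H2 := is_derive_minus _ _ y _ _ (forcing_is_derive y Hy) (dexcess_is_derive y Hy)).
      assert (H3 := is_derive_mult _ _ y _ _ H1 H2 Rmult_comm).
      apply (is_derive_eq _ _ _ _ H3). unfold minus, plus, opp, mult; simpl. ring.
    - intros y Hy. apply Rmult_lt_0_compat; [apply exp_pos | apply dforcing_pos, Hy].
    - intros y Hy.
      assert (Hd := gden_pos y ltac:(lra)).
      assert (Hg0 := g_nonneg y ltac:(lra)). assert (Hg1 := g_lt y ltac:(lra)).
      assert (Hp := fun q => psi_le_0 q).
      assert (HB0 : 0 <= B).
      { unfold B. generalize (Hp (1 / 2) ltac:(lra)) (Psi_le_0 (1 / 2) ltac:(lra)). lra. }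
      assert (HS : 0 <= forcing y).
      { unfold forcing, tangent_at_1. apply Rmult_le_pos; [lra |].
        assert (0 <= r * y / (1 - y)).
        { apply Rdiv_le_0_compat; [apply Rmult_le_pos; lra | lra]. }
        assert (0 <= (1 - g eps y) * - psi (g eps y)).
        { apply Rmult_le_pos; [lra |]. generalize (Hp (g eps y) ltac:(lra)); lra. }
        generalize (Psi_le_0 (g eps y) ltac:(lra)). lra. }
      assert (HN : dexcess y <= B).
      { unfold dexcess, B.
        assert (0 <= eps / gden y * - psi (g eps y)).
        { apply Rmult_le_pos; [apply Rdiv_le_0_compat; lra |].
          generalize (Hp (g eps y) ltac:(lra)); lra. }
        assert ((1 - eps) * - Psi (g eps y) <= - Psi (1 / 2)).
        { generalize (Psi_nonincreasing (g eps y) (1 / 2) ltac:(lra) ltac:(lra))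
            (Psi_le_0 (g eps y) ltac:(lra)). intros. nra. }
        generalize (psi_nonincreasing y (1 / 2) ltac:(lra) ltac:(lra)).
        lra. }
      assert (He := exp_h_le_lin y Hy). fold rho in He.
      assert (He0 := exp_pos (h y)).
      assert (exp (h y) * B <= 4 / rho ^ 2 * y * B) by (apply Rmult_le_compat_r; assumption).
      assert (exp (h y) * - B <= exp (h y) * (forcing y - dexcess y)).
      { apply Rmult_le_compat_l; lra. }
      lra. }
  apply Rnot_le_lt; intros Hle.
  assert (0 <= exp (h x) * (dexcess x - forcing x)).
  { apply Rmult_le_pos; [left; apply exp_pos | lra]. }
  lra.
Qed.

Lemma dexcess_increasing (x y : R) : 0 < x < y -> y < 1 -> dexcess x < dexcess y.
Proof.
  intros Hx Hy.
  destruct (mean_value dexcess (fun x => dh x * (forcing x - dexcess x)) x y)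
    as [c [Hc He]]; [lra | intros; apply dexcess_is_derive; lra |].
  assert (0 < dh c * (forcing c - dexcess c) * (y - x)); [| lra].
  apply Rmult_lt_0_compat; [| lra].
  apply Rmult_lt_0_compat; [apply dh_pos; lra |].
  generalize (dexcess_lt_forcing c ltac:(lra)); lra.
Qed.

(** Convexity. Even for [x = 0] the mean value point is positive, as [dexcess_increasing]
    demands. *)
Lemma excess_above_tangent (a x : R) : 0 < a < 1 -> 0 <= x < 1 ->
  excess a + dexcess a * (x - a) <= excess x.
Proof.
  intros Ha Hx. destruct (Rtotal_order x a) as [H | [-> | H]]; [| lra |].
  - destruct (mean_value excess dexcess x a H) as [c [Hc He]].
    { intros z Hz. apply excess_is_derive; lra. }
    assert (Hm := dexcess_increasing c a ltac:(lra) ltac:(lra)). nra.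
  - destruct (mean_value excess dexcess a x H) as [c [Hc He]].
    { intros z Hz. apply excess_is_derive; lra. }
    assert (Hm := dexcess_increasing a c ltac:(lra) ltac:(lra)). nra.
Qed.

(** * The point of tangency and the unique solvability of the system *)

Definition criterion (x : R) : R := x * dexcess x - excess x.

Lemma criterion_is_derive (x : R) : 0 < x < 1 ->
  is_derive criterion x (x * (dh x * (forcing x - dexcess x))).
Proof.
  intros Hx.
  assert (H1 := is_derive_mult _ _ x _ _ (is_derive_id x) (dexcess_is_derive x Hx) Rmult_comm).
  assert (H2 := is_derive_minus _ _ x _ _ H1 (excess_is_derive x ltac:(lra))).
  apply (is_derive_eq _ _ _ _ H2). unfold minus, plus, opp, mult, one; simpl. ring.
Qed.

Lemma criterion_increasing (x y : R) : 0 < x < y -> y < 1 -> criterion x < criterion y.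
Proof.
  intros Hx Hy.
  destruct (mean_value criterion (fun x => x * (dh x * (forcing x - dexcess x))) x y)
    as [c [Hc He]]; [lra | intros; apply criterion_is_derive; lra |].
  assert (0 < c * (dh c * (forcing c - dexcess c)) * (y - x)); [| lra].
  apply Rmult_lt_0_compat; [| lra]. apply Rmult_lt_0_compat; [lra |].
  apply Rmult_lt_0_compat; [apply dh_pos; lra |].
  generalize (dexcess_lt_forcing c ltac:(lra)); lra.
Qed.

Lemma dexcess_continuous (x : R) : x < 1 -> continuous dexcess x.
Proof.
  intros Hx. assert (Hd := gden_pos x Hx). assert (Hg := g_lt_1 x Hx).
  unfold dexcess.
  apply (continuous_minus (fun x => - (1 - eps) * Psi (g eps x) + eps / gden x * psi (g eps x)) psi).
  - apply (continuous_plus (fun x => - (1 - eps) * Psi (g eps x))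
      (fun x => eps / gden x * psi (g eps x))).
    + apply (continuous_mult (fun _ => - (1 - eps)) (fun x => Psi (g eps x)));
        [apply continuous_const |].
      apply (continuous_comp (g eps) Psi); [apply g_continuous, Hx |].
      apply (continuous_of_is_derive _ _ _ (Psi_is_derive _ Hg)).
    + apply (continuous_mult (fun x => eps / gden x) (fun x => psi (g eps x))).
      * apply (ex_derive_continuous (fun x => eps / gden x)).
        unfold gden in *; auto_derive; lra.
      * apply (continuous_comp (g eps) psi); [apply g_continuous, Hx |].
        apply psi_continuous; assumption.
  - apply psi_continuous; assumption.
Qed.

Lemma criterion_continuous (x : R) : x < 1 -> continuous criterion x.
Proof.
  intros Hx. apply (continuous_minus (fun x => x * dexcess x) excess).
  - apply (continuous_mult (fun x => x) dexcess); [apply continuous_id | apply dexcess_continuous, Hx].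
  - apply (continuous_of_is_derive _ _ _ (excess_is_derive x Hx)).
Qed.

Lemma criterion_0 : criterion 0 = - 1.
Proof.
  unfold criterion, excess, opA. replace (g eps 0) with 0.
  - rewrite Psi_0. ring.
  - unfold g, Rdiv. ring.
Qed.

(** Minus the value at 0 of the tangent to [Psi] at [x]. *)
Definition legendre (x : R) : R := x * psi x - Psi x.

(** The tangent to [A f] at [x] takes at 0 the value 1 plus that of the tangent to [f] at [g x]. *)
Lemma criterion_eq_legendre (x : R) : x < 1 ->
  criterion x = legendre (g eps x) - legendre x - 1.
Proof.
  intros Hx. assert (Hd := gden_pos x Hx).
  unfold criterion, excess, dexcess, opA, legendre. fold (gden x).
  set (p := psi (g eps x)). set (P := Psi (g eps x)).
  replace (g eps x) with (eps * x / gden x) by reflexivity.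
  unfold gden in *. field. lra.
Qed.

(** Derived from the monotonicity of [psi] rather than from legendre' = x psi', in order to include
    [p = 0]; [g x] is 0 when [eps = 0]. *)
Lemma legendre_nonincreasing (p q : R) : 0 <= p <= q -> q < 1 -> legendre q <= legendre p.
Proof.
  intros [Hp [Hpq | <-]] Hq; [| lra].
  destruct (mean_value Psi psi p q Hpq) as [c [Hc He]].
  { intros z Hz. apply Psi_is_derive; lra. }
  assert (H1 := psi_nonincreasing p q ltac:(lra) Hq).
  assert (H2 := psi_nonincreasing c q ltac:(lra) Hq).
  unfold legendre. nra.
Qed.

(** The derivative of [legendre] is x psi'; [dpsi_upper] bounds it on [q, x], with each factor
    replaced by its least value. *)
Lemma legendre_drop (q x : R) : 0 < q < x -> x < 1 ->
  rho * r / (rho + 2) * q / (1 - q) ^ 2 * (x - q) <= legendre q - legendre x.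
Proof.
  intros Hq Hx.
  generalize rho_pos; intros Hr; fold rho in Hr.
  generalize ratio_pos; intros Hr'; fold r in Hr'.
  destruct (mean_value legendre (fun x => x * dpsi x) q x) as [c [Hc He]]; [lra | |].
  { intros z Hz.
    assert (H1 := is_derive_mult _ _ z _ _ (is_derive_id z)
      (psi_is_derive z ltac:(lra)) Rmult_comm).
    assert (H2 := is_derive_minus _ _ z _ _ H1
      (Psi_is_derive z ltac:(lra))).
    apply (is_derive_eq _ _ _ _ H2). unfold minus, plus, opp, mult, one; simpl. ring. }
  replace (legendre q - legendre x) with (c * - dpsi c * (x - q)) by lra.
  apply Rmult_le_compat_r; [lra |].
  assert (Hu := dpsi_upper c ltac:(lra)). fold rho r in Hu.
  assert (Hrr : 0 < rho * r) by (apply Rmult_lt_0_compat; assumption).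
  replace (rho * r / (rho + 2) * q / (1 - q) ^ 2)
    with (q * (rho * r / (rho + 2) / (1 - q) ^ 2)) by (field; lra).
  assert (H1 : 0 < rho * r / (rho + 2)) by (apply Rdiv_lt_0_compat; lra).
  apply Rmult_le_compat; [lra | | lra |].
  - apply Rdiv_le_0_compat; [lra | apply pow_lt; lra].
  - apply Rle_trans with (rho * r / (rho + 2 * c) / (1 - c) ^ 2); [| lra].
    unfold Rdiv. apply Rmult_le_compat.
    + apply Rlt_le, H1.
    + left; apply Rinv_0_lt_compat, pow_lt; lra.
    + apply Rmult_le_compat_l; [lra |]. apply Rinv_le_contravar; lra.
    + apply Rinv_le_contravar; [apply pow_lt; lra |]. apply pow_incr; lra.
Qed.

(* For [x >= 1/2] the map [g] dilates [1 - x] by at least [kappa = 2 / (1 + eps) > 1],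
   so [legendre (g x) - legendre x] grows like [1 / (1 - x)]. *)
Lemma criterion_pos_near_1 : exists x, 0 < x < 1 /\ 0 < criterion x.
Proof.
  generalize rho_pos; intros Hr; fold rho in Hr.
  generalize ratio_pos; intros Hr'; fold r in Hr'.
  set (kappa := 2 / (1 + eps)).
  assert (Hk : kappa * (1 + eps) = 2) by (unfold kappa; field; lra).
  assert (Hk1 : 1 < kappa) by nra.
  assert (Hk2 : kappa <= 2) by nra.
  assert (Hrr : 0 < rho * r) by (apply Rmult_lt_0_compat; assumption).
  (* With [q = 1 - kappa t >= 1/2], the bound of [legendre_drop] between [q] and [1 - t] is at least
     [A / t]. Below, [t <= 1/4] ensures [q >= 1/2], and [t <= A / 2] makes the drop at least 2, more
     than the 1 to be beaten. *)
  set (A := rho * r / (rho + 2) * (1 / 2) * (kappa - 1) / kappa ^ 2).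
  assert (HA : 0 < A).
  { unfold A. apply Rdiv_lt_0_compat; [| apply pow_lt; lra].
    apply Rmult_lt_0_compat; [| lra]. apply Rmult_lt_0_compat; [| lra].
    apply Rdiv_lt_0_compat; lra. }
  set (t := Rmin (1 / 4) (A / 2)).
  assert (Ht : 0 < t) by (apply Rmin_glb_lt; lra).
  assert (Ht1 : t <= 1 / 4) by apply Rmin_l.
  assert (Ht2 : t <= A / 2) by apply Rmin_r.
  exists (1 - t). split; [lra |].
  set (q := 1 - kappa * t).
  assert (Hq : 1 / 2 <= q) by (unfold q; nra).
  assert (Hqt : q < 1 - t) by (unfold q; nra).
  assert (Hgq : g eps (1 - t) <= q).
  { assert (H1 := one_minus_g (1 - t) ltac:(lra)).
    assert (Hd := gden_pos (1 - t) ltac:(lra)).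
    assert (kappa * t <= (1 - (1 - t)) / gden (1 - t)); [| unfold q; lra].
    apply Rmult_le_reg_r with (gden (1 - t)); [lra |].
    replace ((1 - (1 - t)) / gden (1 - t) * gden (1 - t)) with t by (field; lra).
    assert (kappa * gden (1 - t) <= 1) by (unfold gden; nra).
    nra. }
  rewrite criterion_eq_legendre by lra.
  assert (H1 := legendre_nonincreasing (g eps (1 - t)) q
    (conj (g_nonneg (1 - t) ltac:(lra)) Hgq) ltac:(lra)).
  assert (H2 := legendre_drop q (1 - t) ltac:(lra) ltac:(lra)).
  assert (H3 : A / t <= rho * r / (rho + 2) * q / (1 - q) ^ 2 * (1 - t - q)).
  { apply Rle_trans with (rho * r / (rho + 2) * (1 / 2) / (1 - q) ^ 2 * (1 - t - q)).
    - assert (0 < kappa * t) by (apply Rmult_lt_0_compat; lra).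
      right. unfold A, q. field. lra.
    - apply Rmult_le_compat_r; [lra |]. unfold Rdiv.
      apply Rmult_le_compat_r; [left; apply Rinv_0_lt_compat, pow_lt; lra |].
      apply Rmult_le_compat_l; [| lra].
      apply Rlt_le, Rdiv_lt_0_compat; lra. }
  assert (H4 : 2 <= A / t).
  { apply Rmult_le_reg_r with t; [lra |].
    replace (A / t * t) with A by (field; lra). lra. }
  lra.
Qed.

Lemma criterion_root : exists a, 0 < a < 1 /\ criterion a = 0.
Proof.
  destruct criterion_pos_near_1 as [x [Hx Hpos]].
  destruct (IVT_interv criterion 0 x) as [a [Ha Hz]]; try lra.
  - intros z Hz. apply continuity_pt_filterlim, criterion_continuous; lra.
  - rewrite criterion_0; lra.
  - exists a. split; [| exact Hz].
    split; [| lra]. destruct (proj1 Ha) as [H | <-]; [exact H |].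
    rewrite criterion_0 in Hz; lra.
Qed.

Notation solves C a := (solves_system lambda beta gam eps C a).

(* The two equations say that the line [(1 - eps) C x] touches the graph of [excess] at [a]. *)
Lemma solves_system_iff (C a : R) :
  solves C a <->
  0 < a < 1 /\ excess a = (1 - eps) * C * a /\ dexcess a = (1 - eps) * C.
Proof.
  unfold solves_system, excess, dexcess, opA. fold (gden a).
  split; intros [Ha [H1 H2]]; (split; [exact Ha |]); split; unfold gden in *; lra.
Qed.

Lemma system_exists_unique :
  exists! p : R * R, solves (fst p) (snd p).
Proof.
  destruct criterion_root as [a [Ha Hz]].
  exists (dexcess a / (1 - eps), a). split; simpl.
  - apply solves_system_iff. split; [exact Ha |].
    unfold criterion in Hz. split; [| field; lra].
    replace (excess a) with (a * dexcess a) by lra. field; lra.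
  - intros [C b]; simpl. rewrite solves_system_iff. intros [Hb [H1 H2]].
    assert (Hzb : criterion b = 0) by (unfold criterion; rewrite H1, H2; ring).
    assert (Hab : a = b).
    { destruct (Rtotal_order a b) as [H | [H | H]]; [| exact H |].
      - generalize (criterion_increasing a b ltac:(lra) ltac:(lra)); lra.
      - generalize (criterion_increasing b a ltac:(lra) ltac:(lra)); lra. }
    subst b. f_equal. rewrite H2. field; lra.
Qed.

(** * The iterates of g *)

(** The two differences have the same numerator over positive denominators. In this order form the
    inverse relation survives [eps = 0], where [g] is constant. *)
Lemma ginv_gt_iff (q x : R) : 0 < q -> x < 1 -> (g eps x < q <-> x < ginv eps q).
Proof.
  intros Hq Hx. assert (Hd := gden_pos x Hx).
  assert (Hn : 0 < eps + q * (1 - eps)) by nra.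
  assert (E1 : q - g eps x = (q - x * (eps + q * (1 - eps))) / gden x).
  { unfold g, gden in *. field. lra. }
  assert (E2 : ginv eps q - x = (q - x * (eps + q * (1 - eps))) / (eps + q * (1 - eps))).
  { unfold ginv. field. lra. }
  assert (Hs : forall n d, 0 < d -> (0 < n / d <-> 0 < n)).
  { intros n d Hd0. split; intros H.
    - replace n with (n / d * d) by (field; lra). apply Rmult_lt_0_compat; assumption.
    - apply Rdiv_lt_0_compat; assumption. }
  split; intros H.
  - assert (H1 : 0 < q - g eps x) by lra. rewrite E1 in H1. apply Hs in H1; [| exact Hd].
    assert (0 < ginv eps q - x); [| lra]. rewrite E2. apply Hs; assumption.
  - assert (H1 : 0 < ginv eps q - x) by lra. rewrite E2 in H1. apply Hs in H1; [| exact Hn].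
    assert (0 < q - g eps x); [| lra]. rewrite E1. apply Hs; assumption.
Qed.

Lemma ginv_iter_ge (k : nat) (b : R) : 0 < b <= 1 -> b <= ginv_iter eps k b <= 1.
Proof.
  intros Hb. induction k as [| k IH]; [simpl; lra |].
  change (b <= ginv eps (ginv_iter eps k b) <= 1).
  set (q := ginv_iter eps k b) in *.
  assert (Hn : 0 < eps + q * (1 - eps)) by nra.
  assert (H : q <= ginv eps q <= 1); [| lra].
  unfold ginv. split.
  - apply Rmult_le_reg_r with (eps + q * (1 - eps)); [exact Hn |].
    replace (q / (eps + q * (1 - eps)) * (eps + q * (1 - eps))) with q by (field; lra).
    assert (0 <= q * ((1 - q) * (1 - eps))); [| lra].
    apply Rmult_le_pos; [lra |]. apply Rmult_le_pos; lra.
  - apply Rmult_le_reg_r with (eps + q * (1 - eps)); [exact Hn |].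
    replace (q / (eps + q * (1 - eps)) * (eps + q * (1 - eps))) with q by (field; lra).
    assert (0 <= (1 - q) * eps); [| lra]. apply Rmult_le_pos; lra.
Qed.

Lemma not_setD_below (b x : R) : 0 < b < 1 -> x < b -> ~ setD eps b x.
Proof.
  intros Hb Hx [_ [k Hk]]. generalize (ginv_iter_ge k b ltac:(lra)). lra.
Qed.

(** Used in the contrapositive: [g] keeps points off [setD], so second-order statements can be
    transported along [g_induction]. *)
Lemma setD_of_setD_g (b x : R) : 0 < eps -> 0 < x < 1 -> setD eps b (g eps x) -> setD eps b x.
Proof.
  intros He Hx [_ [k Hk]]. split; [lra |]. exists (S k).
  change (x = ginv eps (ginv_iter eps k b)). rewrite <- Hk.
  assert (Hd := gden_pos x ltac:(lra)). unfold g, ginv, gden in *. field. nra.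
Qed.

(* [g] multiplies the odds [x / (1 - x)] by [eps], so its iterates drop below any threshold. *)
Lemma g_induction (b : R) (P : R -> Prop) : 0 < b < 1 ->
  (forall x, x < b -> P x) ->
  (forall x, b <= x < 1 -> P (g eps x) -> P x) ->
  forall x, x < 1 -> P x.
Proof.
  intros Hb H0 HS.
  assert (Hn : forall n x, x < 1 -> eps ^ n * (x / (1 - x)) < b / (1 - b) -> P x).
  { induction n as [| n IH]; intros x Hx Hodds; (destruct (Rlt_le_dec x b) as [L | L]; [auto |]).
    - exfalso. assert (b / (1 - b) <= x / (1 - x)); [| simpl in Hodds; lra].
      unfold Rdiv. apply Rmult_le_compat; [lra | | exact L |].
      + left; apply Rinv_0_lt_compat; lra.
      + apply Rinv_le_contravar; lra.
    - apply HS; [lra |]. apply IH; [apply g_lt_1, Hx |].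
      rewrite one_minus_g by exact Hx. assert (Hd := gden_pos x Hx).
      replace (g eps x / ((1 - x) / gden x)) with (eps * (x / (1 - x))).
      + simpl in Hodds. lra.
      + unfold g, gden in *. field. lra. }
  intros x Hx. destruct (Rlt_le_dec x b) as [L | L]; [auto |].
  assert (Ho : 0 < x / (1 - x)) by (apply Rdiv_lt_0_compat; lra).
  assert (Hob : 0 < b / (1 - b)) by (apply Rdiv_lt_0_compat; lra).
  destruct (pow_lt_1_zero eps ltac:(rewrite Rabs_pos_eq; lra) (b / (1 - b) / (x / (1 - x))))
    as [n Hpow]; [apply Rdiv_lt_0_compat; assumption |].
  apply (Hn n x Hx). specialize (Hpow n (le_n n)).
  apply Rabs_def2 in Hpow.
  apply Rlt_le_trans with (b / (1 - b) / (x / (1 - x)) * (x / (1 - x))).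
  - apply Rmult_lt_compat_r; lra.
  - right. field. lra.
Qed.

(** * The constructed solution *)

Section Solution.

Context (C a : R) (Hsol : solves C a).

(** A V - V equals [excess x - (1 - eps) C x], and the subtracted line is the tangent to the convex
    [excess] at [a]. *)
Lemma solution_le_opA (x : R) : 0 <= x < 1 ->
  Psi x + C <= opA eps (fun y => Psi y + C) x.
Proof.
  intros Hx. destruct (proj1 (solves_system_iff C a) Hsol) as [Ha [H1 H2]].
  assert (H := excess_above_tangent a x Ha Hx). rewrite H1, H2 in H.
  unfold excess, opA in *. lra.
Qed.

(** This is [dexcess a < forcing a] divided by [1 - eps], since [dexcess a = (1 - eps) C]. It is the
    starting inequality for [opL_uext_ge]. *)
Lemma solution_forcing : C + tangent_at_1 (g eps a) <= r * a / (1 - a).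
Proof.
  destruct (proj1 (solves_system_iff C a) Hsol) as [Ha [H1 H2]].
  assert (H := dexcess_lt_forcing a Ha). rewrite H2 in H. unfold forcing in H.
  assert (0 < (1 - eps) * (r * a / (1 - a) - tangent_at_1 (g eps a) - C)) by lra.
  apply Rnot_lt_le; intros Hlt. nra.
Qed.

(** As [Psi] is nonincreasing and [g a < a], the first equation gives V(a) >= 1 + (1 - (1 - eps) a)
    V(a), that is (1 - eps) a V(a) >= 1. *)
Lemma solution_pos : 0 < Psi a + C.
Proof.
  destruct Hsol as [Ha [H1 _]].
  assert (Hd := gden_pos a ltac:(lra)). unfold gden in Hd.
  assert (H := Psi_nonincreasing (g eps a) a ltac:(generalize (g_lt a Ha); lra) ltac:(lra)).
  assert (0 < (1 - eps) * a) by (apply Rmult_lt_0_compat; lra).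
  nra.
Qed.

Lemma a_bounds : 0 < a < 1.
Proof. exact (proj1 Hsol). Qed.

Notation V := (fun y => Psi y + C).

Lemma in_piece_0 (x : R) : 0 <= x < 1 -> (in_piece eps a 0 x <-> x < a).
Proof. intros Hx. simpl. lra. Qed.

(** This shift turns the definition of [u] by pieces into the recursion u = A u. *)
Lemma in_piece_S (k : nat) (x : R) : a <= x < 1 ->
  (in_piece eps a (S k) x <-> in_piece eps a k (g eps x)).
Proof.
  intros Hx. assert (Ha := a_bounds).
  assert (Hq : forall j, (g eps x < ginv_iter eps j a <-> x < ginv_iter eps (S j) a)).
  { intros j. apply ginv_gt_iff; [| lra]. generalize (ginv_iter_ge j a ltac:(lra)); lra. }
  destruct k as [| j].
  - assert (H := Hq 0%nat). assert (Hg := g_nonneg x ltac:(lra)). simpl in *. lra.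
  - assert (H1 := Hq j). assert (H2 := Hq (S j)). unfold in_piece. lra.
Qed.

Lemma in_piece_S_ge (k : nat) (x : R) : in_piece eps a (S k) x -> a <= x.
Proof.
  intros H. assert (Ha := a_bounds).
  generalize (ginv_iter_ge k a ltac:(lra)). simpl in H. lra.
Qed.

Lemma in_piece_unique (k j : nat) (x : R) : 0 <= x < 1 ->
  in_piece eps a k x -> in_piece eps a j x -> k = j.
Proof.
  revert j x. induction k as [| k IH]; intros [| j] x Hx Hk Hj; try reflexivity.
  - apply in_piece_S_ge in Hj. simpl in Hk. lra.
  - apply in_piece_S_ge in Hk. simpl in Hj. lra.
  - assert (L := in_piece_S_ge _ _ Hk). f_equal. apply (IH j (g eps x)).
    + split; [apply g_nonneg, Hx | apply g_lt_1, Hx].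
    + apply in_piece_S; [lra | exact Hk].
    + apply in_piece_S; [lra | exact Hj].
Qed.

Lemma in_piece_exists (x : R) : 0 <= x < 1 -> exists k, in_piece eps a k x.
Proof.
  intros Hx. assert (Ha := a_bounds).
  apply (g_induction a (fun x => 0 <= x -> exists k, in_piece eps a k x) Ha); try lra.
  - intros y Hy Hy0. exists 0%nat. simpl; lra.
  - intros y Hy IH Hy0. destruct IH as [k Hk]; [apply g_nonneg; lra |].
    exists (S k). apply in_piece_S; assumption.
Qed.

Lemma piece_index_eq (k : nat) (x : R) : 0 <= x < 1 ->
  in_piece eps a k x -> piece_index eps a x = k.
Proof.
  intros Hx Hk. apply (in_piece_unique _ _ x Hx); [| exact Hk].
  unfold piece_index. apply epsilon_spec. exists k; exact Hk.
Qed.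

(* [u_left] is junk on the negative axis, where no piece lies; this extension is C^1 on
   (-oo, 1), which spares one-sided arguments at 0. *)
Definition uext (x : R) : R :=
  if Rlt_dec x 0 then V x else u_left lambda beta gam eps C a x.

Lemma uext_eq (x : R) : 0 <= x -> uext x = u_left lambda beta gam eps C a x.
Proof. intros Hx. unfold uext. destruct (Rlt_dec x 0); lra. Qed.

Lemma uext_below (x : R) : x < a -> uext x = V x.
Proof.
  intros Hx. assert (Ha := a_bounds). unfold uext.
  destruct (Rlt_dec x 0) as [L | L]; [reflexivity |].
  unfold u_left. rewrite (piece_index_eq 0); [reflexivity | lra |].
  apply in_piece_0; lra.
Qed.

Lemma uext_above (x : R) : a <= x < 1 -> uext x = opA eps uext x.
Proof.
  intros Hx. assert (Ha := a_bounds).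
  assert (Hg0 := g_nonneg x ltac:(lra)). assert (Hg1 := g_lt_1 x ltac:(lra)).
  destruct (in_piece_exists (g eps x) ltac:(lra)) as [k Hk].
  unfold opA. rewrite !uext_eq by lra. unfold u_left.
  rewrite (piece_index_eq k (g eps x)), (piece_index_eq (S k) x).
  - reflexivity.
  - lra.
  - apply in_piece_S; assumption.
  - lra.
  - exact Hk.
Qed.

Notation U := uext.
Notation dU := (Derive uext).

Lemma V_is_derive (x : R) : x < 1 -> is_derive V x (psi x).
Proof.
  intros Hx.
  assert (H := is_derive_plus _ _ x _ _ (Psi_is_derive x Hx) (is_derive_const C x)).
  apply (is_derive_eq _ _ _ _ H). unfold plus, zero; simpl. ring.
Qed.

Lemma g_a_lt : g eps a < a.
Proof. apply g_lt, a_bounds. Qed.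

Lemma uext_is_derive_below (x : R) : x < a -> is_derive U x (psi x).
Proof.
  intros Hx. assert (Ha := a_bounds).
  apply is_derive_ext_loc with V; [| apply V_is_derive; lra].
  generalize (locally_lt x a Hx). apply filter_imp. intros y Hy.
  symmetry; apply uext_below, Hy.
Qed.

Lemma Derive_uext_below (x : R) : x < a -> dU x = psi x.
Proof. intros Hx. apply is_derive_unique, uext_is_derive_below, Hx. Qed.

(** Continuous fit: the first equation of the system. *)
Lemma uext_at_a : U a = V a.
Proof.
  assert (Ha := a_bounds). rewrite uext_above by lra. unfold opA.
  rewrite uext_below by apply g_a_lt.
  destruct Hsol as [_ [H _]]. lra.
Qed.

(** The second equation of the system: the derivatives of the two branches agree at [a]. *)
Lemma smooth_fit :
  psi a = - (1 - eps) * U (g eps a) + eps / gden a * dU (g eps a).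
Proof.
  rewrite uext_below, Derive_uext_below by apply g_a_lt.
  destruct Hsol as [_ [_ H]]. unfold gden. lra.
Qed.

Lemma uext_is_derive_a : is_derive U a (psi a).
Proof.
  assert (Ha := a_bounds).
  apply (is_derive_glue U V (opA eps U)).
  - apply V_is_derive; lra.
  - rewrite smooth_fit. apply opA_is_derive; [lra |]. intros _.
    rewrite Derive_uext_below by apply g_a_lt.
    apply uext_is_derive_below, g_a_lt.
  - apply uext_at_a.
  - apply uext_above; lra.
  - generalize (locally_lt a 1 (proj2 Ha)). apply filter_imp. intros y Hy.
    destruct (Rlt_le_dec y a) as [L | L].
    + left; apply uext_below, L.
    + right; apply uext_above; lra.
Qed.

Lemma Derive_uext_le_a (x : R) : x <= a -> dU x = psi x.
Proof.
  intros [Hx | ->]; [apply Derive_uext_below, Hx |].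
  apply is_derive_unique, uext_is_derive_a.
Qed.

Lemma uext_is_derive_above (x : R) : a < x < 1 -> ex_derive U (g eps x) ->
  is_derive U x (- (1 - eps) * U (g eps x) + eps / gden x * dU (g eps x)).
Proof.
  intros Hx He. assert (Ha := a_bounds).
  apply is_derive_ext_loc with (opA eps U).
  - generalize (locally_between x a 1 Hx). apply filter_imp. intros y Hy.
    symmetry; apply uext_above; lra.
  - apply opA_is_derive; [lra |]. intros _. apply Derive_correct, He.
Qed.

Lemma uext_ex_derive (x : R) : x < 1 -> ex_derive U x.
Proof.
  revert x. apply (g_induction a _ a_bounds).
  - intros x Hx. exists (psi x). apply uext_is_derive_below, Hx.
  - intros x [[Hx | <-] Hx1] IH.
    + eexists. apply uext_is_derive_above; [lra | exact IH].
    + exists (psi a). apply uext_is_derive_a.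
Qed.

Lemma uext_is_derive (x : R) : x < 1 -> is_derive U x (dU x).
Proof. intros Hx. apply Derive_correct, uext_ex_derive, Hx. Qed.

Lemma uext_continuous (x : R) : x < 1 -> continuous U x.
Proof. intros Hx. apply (ex_derive_continuous U), uext_ex_derive, Hx. Qed.

Lemma Derive_uext_above (x : R) : a <= x < 1 ->
  dU x = - (1 - eps) * U (g eps x) + eps / gden x * dU (g eps x).
Proof.
  intros [[Hx | <-] Hx1].
  - apply is_derive_unique, uext_is_derive_above; [lra |].
    apply uext_ex_derive, g_lt_1, Hx1.
  - rewrite Derive_uext_le_a by lra. apply smooth_fit.
Qed.

Lemma Derive_uext_continuous (x : R) : x < 1 -> continuous dU x.
Proof.
  assert (Ha := a_bounds). revert x. apply (g_induction a _ a_bounds).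
  - intros x Hx. apply continuous_ext_loc with psi; [| apply psi_continuous; lra].
    generalize (locally_lt x a Hx). apply filter_imp. intros y Hy.
    symmetry; apply Derive_uext_below, Hy.
  - intros x Hx IH. assert (Hd := gden_pos x (proj2 Hx)).
    set (F := fun y => - (1 - eps) * U (g eps y) + eps / gden y * dU (g eps y)).
    assert (HF : continuous F x).
    { apply (continuous_plus (fun y => - (1 - eps) * U (g eps y))
        (fun y => eps / gden y * dU (g eps y))).
      - apply (continuous_mult (fun _ => - (1 - eps)) (fun y => U (g eps y)));
          [apply continuous_const |].
        apply (continuous_comp (g eps) U); [apply g_continuous; lra |].
        apply uext_continuous, g_lt_1; lra.
      - apply (continuous_mult (fun y => eps / gden y) (fun y => dU (g eps y))).
        + apply (ex_derive_continuous (fun y => eps / gden y)).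
          unfold gden in *; auto_derive; lra.
        + apply (continuous_comp (g eps) dU); [apply g_continuous; lra | exact IH]. }
    destruct (proj1 Hx) as [L | <-].
    + apply continuous_ext_loc with F; [| exact HF].
      generalize (locally_between x a 1 (conj L (proj2 Hx))). apply filter_imp. intros y Hy.
      symmetry; apply Derive_uext_above; lra.
    + apply (continuous_glue dU psi F); try assumption.
      * apply psi_continuous; lra.
      * apply Derive_uext_le_a; lra.
      * apply Derive_uext_above; lra.
      * generalize (locally_lt a 1 (proj2 Ha)). apply filter_imp. intros y Hy.
        destruct (Rlt_le_dec y a) as [L | L].
        -- left; apply Derive_uext_below, L.
        -- right; apply Derive_uext_above; lra.
Qed.

(** * Concavity, monotonicity and positivity of u *)

Lemma uext_sub_ge (p q : R) : 0 <= p <= q -> q < 1 ->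
  (forall z, 0 <= z <= q -> dU q <= dU z) -> (q - p) * dU q <= U q - U p.
Proof.
  intros [Hp [Hpq | <-]] Hq Hm; [| lra].
  destruct (mean_value U dU p q Hpq) as [c [Hc He]].
  { intros z Hz. apply uext_is_derive; lra. }
  rewrite He, Rmult_comm. apply Rmult_le_compat_r; [lra |]. apply Hm; lra.
Qed.

(** Being affine in [g x], this form makes the comparison of derivatives at two points
    polynomial. *)
Lemma eps_div_gden (x : R) : x < 1 -> eps / gden x = eps + (1 - eps) * g eps x.
Proof.
  intros Hx. assert (Hd := gden_pos x Hx). unfold g, gden in *. field. lra.
Qed.

(** The induction runs over the upper point [y], with all lower points quantified inside, because
    [g x] is another point below [g y]. *)
Lemma Derive_uext_nonincreasing (x y : R) : 0 <= x <= y -> y < 1 -> dU y <= dU x.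
Proof.
  assert (Ha := a_bounds).
  intros Hxy Hy. revert x Hxy. revert y Hy.
  apply (g_induction a (fun y => forall x, 0 <= x <= y -> dU y <= dU x) Ha).
  - intros y Hy x Hx. rewrite !Derive_uext_le_a by lra. apply psi_nonincreasing; lra.
  - intros y Hy IH.
    assert (H : forall x, a <= x <= y -> dU y <= dU x).
    { intros x Hx. rewrite (Derive_uext_above x), (Derive_uext_above y), (eps_div_gden x), (eps_div_gden y) by lra.
      assert (Hg := g_le x y ltac:(lra) ltac:(lra)).
      assert (Hg0 := g_nonneg x ltac:(lra)). assert (Hg1 := g_lt_1 y ltac:(lra)).
      assert (H1 := IH (g eps x) ltac:(lra)).
      assert (H2 := uext_sub_ge (g eps x) (g eps y) ltac:(lra) Hg1 IH).
      set (p := g eps x) in *. set (q := g eps y) in *.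
      (* [dU x - dU y] is the sum of the first and third expressions; the bracket in the third is
         the concavity defect [U q - U p - (q - p) * dU q] plus the second expression. *)
      assert (0 <= eps * (dU p - dU q)) by (apply Rmult_le_pos; lra).
      assert (0 <= p * (dU p - dU q)) by (apply Rmult_le_pos; lra).
      assert (0 <= (1 - eps) * (U q - U p - q * dU q + p * dU p)) by (apply Rmult_le_pos; lra).
      lra. }
    intros x Hx. destruct (Rle_lt_dec a x) as [L | L]; [apply H; lra |].
    apply Rle_trans with (dU a); [apply H; lra |].
    rewrite !Derive_uext_le_a by lra. apply psi_nonincreasing; lra.
Qed.

Lemma uext_nonincreasing (x y : R) : 0 <= x <= y -> y < 1 -> U y <= U x.
Proof.
  intros [Hx [Hxy | <-]] Hy; [| lra]. assert (Ha := a_bounds).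
  destruct (mean_value U dU x y Hxy) as [c [Hc He]].
  { intros z Hz. apply uext_is_derive; lra. }
  assert (Hd := Derive_uext_nonincreasing 0 c ltac:(lra) ltac:(lra)).
  rewrite (Derive_uext_below 0), psi_nonpos_arg in Hd by lra. nra.
Qed.

(** Supplies the lower bound from which the limit at 1 exists. *)
Lemma uext_pos (x : R) : 0 <= x < 1 -> 0 < U x.
Proof.
  assert (Ha := a_bounds). intros [Hx Hx1]. revert Hx. revert x Hx1.
  apply (g_induction a (fun x => 0 <= x -> 0 < U x) Ha).
  - intros x Hx Hx0. rewrite uext_below by exact Hx.
    generalize (Psi_nonincreasing x a ltac:(lra) ltac:(lra)) solution_pos. lra.
  - intros x Hx IH Hx0. rewrite uext_above by exact Hx. unfold opA. fold (gden x).
    assert (0 < gden x * U (g eps x)); [| lra].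
    apply Rmult_lt_0_compat; [apply gden_pos; lra | apply IH, g_nonneg; lra].
Qed.

Lemma uext_le_opA (x : R) : 0 <= x < 1 -> U x <= opA eps U x.
Proof.
  intros Hx. destruct (Rlt_le_dec x a) as [L | L].
  - rewrite uext_below by exact L. apply Rle_trans with (1 := solution_le_opA x Hx).
    right. unfold opA. rewrite uext_below; [reflexivity |].
    destruct (Rle_lt_dec x 0) as [L0 | L0].
    + replace x with 0 by lra. unfold g, Rdiv. rewrite Rmult_0_r, Rmult_0_l. apply a_bounds.
    + generalize (g_lt x ltac:(lra)); lra.
  - right. apply uext_above; lra.
Qed.

(** * Second derivative of u and the inequality for L u *)

Notation ddU := (Derive (Derive uext)).

Lemma ddu_below (x : R) : 0 < x < a -> is_derive dU x (dpsi x).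
Proof.
  intros Hx. assert (Ha := a_bounds).
  apply is_derive_ext_loc with psi; [| apply psi_is_derive; lra].
  generalize (locally_lt x a (proj2 Hx)). apply filter_imp. intros y Hy.
  symmetry; apply Derive_uext_below, Hy.
Qed.

Lemma ddu_above (x : R) : a < x < 1 -> (0 < eps -> ex_derive dU (g eps x)) ->
  is_derive dU x (eps ^ 2 / gden x ^ 3 * ddU (g eps x)).
Proof.
  intros Hx He. assert (Ha := a_bounds).
  apply is_derive_ext_loc with (fun y => - (1 - eps) * U (g eps y) + eps / gden y * dU (g eps y)).
  - generalize (locally_between x a 1 Hx). apply filter_imp. intros y Hy.
    symmetry; apply Derive_uext_above; lra.
  - apply (dopA_is_derive U dU); [lra | |].
    + intros _. apply uext_is_derive, g_lt_1; lra.
    + intros H. apply Derive_correct, He, H.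
Qed.

(** [Derive] is total, so differentiability on a neighbourhood has to be carried along; continuity
    of [g] pulls this neighbourhood back. *)
Lemma uext_C2 (x : R) : 0 < x < 1 -> ~ setD eps a x ->
  locally x (ex_derive dU) /\ continuous ddU x.
Proof.
  assert (Ha := a_bounds). intros [Hx0 Hx]. revert Hx0. revert x Hx.
  apply (g_induction a (fun x => 0 < x -> ~ setD eps a x ->
    locally x (ex_derive dU) /\ continuous ddU x) Ha).
  - intros x Hx Hx0 _.
    assert (Hl := locally_between x 0 a (conj Hx0 Hx)). split.
    + revert Hl. apply filter_imp. intros y Hy. exists (dpsi y). apply ddu_below, Hy.
    + apply continuous_ext_loc with dpsi; [| apply dpsi_continuous; lra].
      revert Hl. apply filter_imp. intros y Hy.
      symmetry; apply is_derive_unique, ddu_below, Hy.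
  - intros x [[Hx | <-] Hx1] IH Hx0 HD.
    2: { exfalso; apply HD. split; [lra |]. exists 0%nat; reflexivity. }
    assert (Hd := gden_pos x Hx1).
    assert (He : 0 < eps -> locally (g eps x) (ex_derive dU) /\ continuous ddU (g eps x)).
    { intros He. apply IH; [apply g_pos; lra |].
      intros H; apply HD, setD_of_setD_g; lra || assumption. }
    assert (Hl : locally x (fun y => is_derive dU y (eps ^ 2 / gden y ^ 3 * ddU (g eps y)))).
    { assert (Hlx := locally_between x a 1 (conj Hx Hx1)).
      destruct (proj1 Heps) as [He0 | He0].
      - destruct (He He0) as [Hg _]. apply (g_continuous x Hx1) in Hg.
        generalize (filter_and _ _ Hlx Hg). apply filter_imp. intros y [Hy Hgy].
        apply ddu_above; [exact Hy | intros _; exact Hgy].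
      - revert Hlx. apply filter_imp. intros y Hy. apply ddu_above; lra. }
    split.
    + revert Hl. apply filter_imp. intros y Hy. eexists; exact Hy.
    + apply continuous_ext_loc with (fun y => eps ^ 2 / gden y ^ 3 * ddU (g eps y)).
      { revert Hl. apply filter_imp. intros y Hy. symmetry; apply is_derive_unique, Hy. }
      destruct (proj1 Heps) as [He0 | He0].
      * apply (continuous_mult (fun y => eps ^ 2 / gden y ^ 3) (fun y => ddU (g eps y))).
        -- apply (ex_derive_continuous (fun y => eps ^ 2 / gden y ^ 3)).
           unfold gden in *; auto_derive.
           apply Rgt_not_eq. repeat apply Rmult_lt_0_compat; lra.
        -- apply (continuous_comp (g eps) ddU); [apply g_continuous, Hx1 | apply He, He0].
      (* For [eps = 0] the function is affine above [a]. *)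
      * apply continuous_ext with (fun _ => 0); [| apply continuous_const].
        intros y. rewrite <- He0. unfold Rdiv. real_eq. ring.
Qed.

(** Formally the derivative is (1 - q) u'' <= 0; mean values avoid u'', which may not exist on
    [setD]. *)
Lemma uext_tangent_at_1_nonincreasing (p q : R) : 0 <= p <= q -> q < 1 ->
  U q + (1 - q) * dU q <= U p + (1 - p) * dU p.
Proof.
  intros [Hp [Hpq | <-]] Hq; [| lra].
  destruct (mean_value U dU p q Hpq) as [c [Hc He]].
  { intros z Hz. apply uext_is_derive; lra. }
  assert (H1 := Derive_uext_nonincreasing p c ltac:(lra) ltac:(lra)).
  assert (H2 := Derive_uext_nonincreasing p q ltac:(lra) ltac:(lra)).
  nra.
Qed.

Lemma opL_uext_below (x : R) : 0 < x < a -> opL lambda gam U x = - beta * x.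
Proof.
  intros Hx. assert (Ha := a_bounds). unfold opL.
  rewrite Derive_uext_below by lra.
  change (Derive_n U 2 x) with (ddU x).
  rewrite (is_derive_unique _ _ _ (ddu_below x Hx)).
  unfold dpsi, dh, r. field. lra.
Qed.

Lemma opL_uext_ge (x : R) : 0 < x < 1 -> ~ setD eps a x ->
  - beta * x <= opL lambda gam U x.
Proof.
  assert (Ha := a_bounds). intros [Hx0 Hx]. revert Hx0. revert x Hx.
  apply (g_induction a (fun x => 0 < x -> ~ setD eps a x -> - beta * x <= opL lambda gam U x) Ha).
  - intros x Hx Hx0 _. right. symmetry. apply opL_uext_below; lra.
  - intros x [[Hx | <-] Hx1] IH Hx0 HD.
    2: { exfalso; apply HD. split; [lra |]. exists 0%nat; reflexivity. }
    assert (Hd := gden_pos x Hx1).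
    assert (Hnd : 0 < eps -> ~ setD eps a (g eps x)).
    { intros He H. apply HD, setD_of_setD_g; lra || assumption. }
    assert (Hg0 := g_nonneg x ltac:(lra)). assert (Hg1 := g_lt_1 x Hx1).
    assert (IHg : - beta * g eps x <= opL lambda gam U (g eps x)).
    { destruct (proj1 Heps) as [He | He].
      - apply IH; [apply g_pos; lra | apply Hnd, He].
      (* The induction hypothesis excludes 0, but there both sides vanish: [psi 0 = 0], and the
         second-order coefficient is 0. *)
      - rewrite g_eps_0 by lra. unfold opL. rewrite Derive_uext_below, psi_nonpos_arg by lra. lra. }
    (* In the notation of the overview: T_u(g(x)) <= T_u(g(a)) = C + T(g(a)) <= m(a) <= m(x). *)
    assert (Ht : U (g eps x) + (1 - g eps x) * dU (g eps x) <= r * x / (1 - x)).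
    { assert (Hga := g_le a x ltac:(lra) Hx1). assert (Hga0 := g_nonneg a ltac:(lra)).
      apply Rle_trans with (1 := uext_tangent_at_1_nonincreasing (g eps a) (g eps x)
        ltac:(lra) Hg1).
      rewrite uext_below, Derive_uext_below by apply g_a_lt.
      assert (H := solution_forcing). unfold tangent_at_1 in H.
      apply Rle_trans with (r * a / (1 - a)); [lra |].
      unfold Rdiv. rewrite !Rmult_assoc. apply Rmult_le_compat_l.
      - apply Rlt_le, ratio_pos.
      - apply Rmult_le_compat; [lra | | lra |].
        + left; apply Rinv_0_lt_compat; lra.
        + apply Rinv_le_contravar; lra. }
    unfold opL in *. change (Derive_n U 2 x) with (ddU x).
    change (Derive_n U 2 (g eps x)) with (ddU (g eps x)) in IHg.
    rewrite Derive_uext_above by lra.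
    rewrite (is_derive_unique _ _ _ (ddu_above x (conj Hx Hx1)
      (fun He => locally_singleton _ _ (proj1 (uext_C2 (g eps x)
        (conj (g_pos x He (conj Hx0 Hx1)) Hg1) (Hnd He)))))).
    set (A := U (g eps x)) in *. set (B := dU (g eps x)) in *. set (D := ddU (g eps x)) in *.
    set (Z := lambda * (1 - g eps x) * B + gam * g eps x ^ 2 * (1 - g eps x) ^ 2 * D) in *.
    (* With D = [gden x]: L(A u)(x) = D (L u)(g(x)) - (1 - eps) lambda (1 - x) T_u(g(x)). Since D
       g(x) = eps x, the two terms are at least - eps beta x and - (1 - eps) beta x. *)
    replace (lambda * (1 - x) * (- (1 - eps) * A + eps / gden x * B) +
             gam * x ^ 2 * (1 - x) ^ 2 * (eps ^ 2 / gden x ^ 3 * D))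
      with (gden x * Z - (1 - eps) * (lambda * (1 - x)) * (A + (1 - g eps x) * B)).
    + assert (H1 : gden x * (- beta * g eps x) <= gden x * Z) by (apply Rmult_le_compat_l; lra).
      replace (gden x * (- beta * g eps x)) with (- beta * (gden x * g eps x)) in H1 by ring.
      rewrite gden_mul_g in H1 by exact Hx1.
      assert (H2 : lambda * (1 - x) * (A + (1 - g eps x) * B) <= beta * x).
      { replace (beta * x) with (lambda * (1 - x) * (r * x / (1 - x))) by (unfold r; field; lra).
        apply Rmult_le_compat_l; [apply Rmult_le_pos; lra | exact Ht]. }
      assert (H3 : (1 - eps) * (lambda * (1 - x) * (A + (1 - g eps x) * B)) <= (1 - eps) * (beta * x)).
      { apply Rmult_le_compat_l; lra. }
      lra.
    + unfold Z. unfold g, gden in *. field. lra.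
Qed.

(** * Transfer to [u] on [0, 1] *)

Notation ustar := (u lambda beta gam eps C a).

Lemma ustar_eq (x : R) : 0 <= x < 1 -> ustar x = U x.
Proof.
  intros Hx. unfold u. destruct (Rlt_dec x 1) as [L | L]; [| lra].
  symmetry; apply uext_eq; lra.
Qed.

Lemma ustar_locally (x : R) : 0 < x < 1 -> locally x (fun y => ustar y = U y).
Proof.
  intros Hx. generalize (locally_between x 0 1 Hx). apply filter_imp.
  intros y Hy. apply ustar_eq; lra.
Qed.

Lemma ustar_from_1 : exists l, filterlim U (at_left 1) (locally l) /\
  forall x, 1 <= x -> ustar x = l.
Proof.
  destruct (nonincreasing_limit_left U) as [l Hl].
  - intros; apply uext_nonincreasing; assumption.
  - intros x Hx; left; apply uext_pos, Hx.
  - exists l. split; [exact Hl |]. intros x Hx.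
    unfold u. destruct (Rlt_dec x 1) as [L | L]; [lra |].
    apply (iota_filterlim_locally (u_left lambda beta gam eps C a) l).
    apply filterlim_ext_loc with U; [| exact Hl].
    change (locally 1 (fun y => y < 1 -> U y = u_left lambda beta gam eps C a y)).
    generalize (locally_gt 1 0 Rlt_0_1). apply filter_imp. intros y Hy _.
    apply uext_eq; lra.
Qed.

(** Extends [u] from [0, 1] by [V] on the left and by a constant on the right, so that continuity is
    two-sided at both endpoints. *)
Definition ubar (x : R) : R := if Rlt_dec x 1 then U x else ustar 1.

Lemma ubar_eq (x : R) : x < 1 -> ubar x = U x.
Proof. intros Hx. unfold ubar. destruct (Rlt_dec x 1); lra. Qed.

Lemma ustar_eq_ubar (x : R) : 0 <= x <= 1 -> ubar x = ustar x.
Proof.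
  intros Hx. unfold ubar. destruct (Rlt_dec x 1) as [L | L].
  - symmetry; apply ustar_eq; lra.
  - replace x with 1 by lra. reflexivity.
Qed.

Lemma ubar_continuous (x : R) : x <= 1 -> continuous ubar x.
Proof.
  intros [Hx | ->].
  - apply continuous_ext_loc with U; [| apply uext_continuous, Hx].
    generalize (locally_lt x 1 Hx). apply filter_imp. intros y Hy.
    symmetry; apply ubar_eq, Hy.
  - destruct ustar_from_1 as [l [Hl H1]].
    intros P HP. unfold ubar at 1 in HP.
    destruct (Rlt_dec 1 1) as [L | _]; [lra |]. rewrite H1 in HP by lra.
    change (locally 1 (fun y => P (ubar y))).
    assert (Q : locally 1 (fun y => y < 1 -> P (U y))) by exact (Hl P HP).
    revert Q. apply filter_imp. intros y Hy. unfold ubar.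
    destruct (Rlt_dec y 1) as [L | L]; [auto |].
    rewrite H1 by lra. apply locally_singleton, HP.
Qed.

Lemma ustar_concave : concave_on (fun x => 0 <= x <= 1) ustar.
Proof.
  assert (H : concave_on (fun x => 0 <= x <= 1) ubar).
  { apply concave_on_of_derive with dU.
    - intros x Hx. apply ubar_continuous; lra.
    - intros x Hx. apply is_derive_ext_loc with U; [| apply uext_is_derive; lra].
      generalize (locally_lt x 1 (proj2 Hx)). apply filter_imp. intros y Hy.
      symmetry; apply ubar_eq, Hy.
    - intros x y Hx Hy. apply Derive_uext_nonincreasing; lra. }
  intros x y t Hx Hy Ht. rewrite <- !ustar_eq_ubar; try assumption.
  - apply H; assumption.
  - split; nra.
Qed.

Lemma Derive_ustar (x : R) : 0 < x < 1 -> Derive ustar x = dU x.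
Proof. intros Hx. apply Derive_ext_loc, ustar_locally, Hx. Qed.

Lemma Derive_ustar_locally (x : R) : 0 < x < 1 ->
  locally x (fun y => Derive ustar y = dU y).
Proof.
  intros Hx. generalize (locally_between x 0 1 Hx). apply filter_imp.
  intros y Hy. apply Derive_ustar, Hy.
Qed.

(** The value [- r] is the limit of psi' at 0, by [dpsi_lower] and [dpsi_upper]. *)
Definition ddu_closure (x : R) : R := if Rlt_dec 0 x then ddU x else - r.

Lemma ddu_closure_continuous (x : R) : 0 <= x < 1 -> ~ setD eps a x ->
  continuous ddu_closure x.
Proof.
  assert (Ha := a_bounds). assert (Hr := rho_pos). fold rho in Hr.
  assert (Hr' := ratio_pos). fold r in Hr'.
  intros [[Hx | <-] Hx1] HD.
  - apply continuous_ext_loc with ddU; [| apply uext_C2; [lra | exact HD]].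
    generalize (locally_gt x 0 Hx). apply filter_imp. intros y Hy.
    unfold ddu_closure. destruct (Rlt_dec 0 y); lra.
  - apply (continuous_of_local_bound ddu_closure 0 (Rmin a (1 / 2)) (8 * r + 2 * r / rho)).
    { apply Rmin_glb_lt; lra. }
    intros y Hy. generalize (Rmin_l a (1 / 2)) (Rmin_r a (1 / 2)); intros Hm1 Hm2.
    assert (HM : 0 < 2 * r / rho) by (apply Rdiv_lt_0_compat; lra).
    unfold ddu_closure. destruct (Rlt_dec 0 0) as [L | _]; [lra |]. rewrite Rminus_0_r.
    destruct (Rlt_dec 0 y) as [L | L].
    + rewrite (is_derive_unique _ _ _ (ddu_below y ltac:(lra))).
      rewrite (Rabs_pos_eq y) by lra.
      assert (H1 := dpsi_lower y ltac:(lra)). assert (H2 := dpsi_upper y ltac:(lra)).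
      assert (Hsq : 1 / 4 <= (1 - y) ^ 2 <= 1) by (simpl; split; nra).
      (* On (0, 1/2), [(1 + 8 y) (1 - y) ^ 2 - 1 = y (6 - 15 y + 8 y ^ 2) >= 0]. This and
         [rho / (rho + 2 y) >= 1 - 2 y / rho] below give the two parts of the Lipschitz constant. *)
      assert (E1 : r / (1 - y) ^ 2 <= r + 8 * r * y).
      { apply Rmult_le_reg_r with ((1 - y) ^ 2); [lra |].
        replace (r / (1 - y) ^ 2 * (1 - y) ^ 2) with r by (field; lra).
        assert (0 <= r * y * (6 - 15 * y + 8 * y ^ 2)); [| nra].
        apply Rmult_le_pos; [apply Rmult_le_pos; lra |]. nra. }
      assert (E2 : r - 2 * r / rho * y <= rho * r / (rho + 2 * y) / (1 - y) ^ 2).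
      { apply Rle_trans with (rho * r / (rho + 2 * y)).
        - assert (0 <= 2 * r * y * (2 * y) / (rho * (rho + 2 * y))).
          { apply Rdiv_le_0_compat.
            - apply Rmult_le_pos; [| lra]. apply Rmult_le_pos; lra.
            - apply Rmult_lt_0_compat; lra. }
          replace (rho * r / (rho + 2 * y))
            with (r - 2 * r / rho * y + 2 * r * y * (2 * y) / (rho * (rho + 2 * y)))
            by (field; lra).
          lra.
        - assert (0 <= rho * r / (rho + 2 * y)).
          { apply Rdiv_le_0_compat; [apply Rmult_le_pos |]; lra. }
          unfold Rdiv at 2. rewrite <- (Rmult_1_r (rho * r / (rho + 2 * y))) at 1.
          apply Rmult_le_compat_l; [assumption |]. rewrite <- Rinv_1 at 1.
          apply Rinv_le_contravar; lra. }
      assert (0 < r * y) by (apply Rmult_lt_0_compat; lra).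
      assert (0 < 2 * r / rho * y) by (apply Rmult_lt_0_compat; lra).
      apply Rabs_le. unfold Rdiv in H1. rewrite <- Ropp_mult_distr_l in H1.
      fold (r / (1 - y) ^ 2) in H1. split; lra.
    + replace (- r - - r) with 0 by ring. rewrite Rabs_R0.
      apply Rmult_le_pos; [lra | apply Rabs_pos].
Qed.

Lemma ustar_continuous_on (J : R -> Prop) :
  (forall x, J x -> 0 <= x <= 1) -> continuous_on J ustar.
Proof.
  intros HJ. apply continuous_on_ext with ubar.
  - intros x Hx. apply ustar_eq_ubar, HJ, Hx.
  - apply continuous_on_of_continuous. intros x Hx. apply ubar_continuous, HJ, Hx.
Qed.

Lemma ustar_C1_class (J : R -> Prop) : (forall x, J x -> 0 <= x < 1) ->
  (forall x, J x -> 0 < x < 1 -> ex_derive_n ustar 1 x) /\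
  exists w, continuous_on J w /\
    forall x, J x -> 0 < x < 1 -> w x = Derive_n ustar 1 x.
Proof.
  intros HJ. split.
  - intros x _ Hx. apply ex_derive_ext_loc with U; [| apply uext_ex_derive; lra].
    generalize (ustar_locally x Hx). apply filter_imp. intros y Hy; symmetry; exact Hy.
  - exists dU. split.
    + apply continuous_on_of_continuous. intros x Hx.
      apply Derive_uext_continuous, HJ, Hx.
    + intros x _ Hx. symmetry; apply (Derive_ustar x Hx).
Qed.

Lemma ustar_regular : regular eps a ustar.
Proof.
  split; [| split].
  - split; [apply ustar_continuous_on; auto |]. intros k Hk; lia.
  - split; [apply ustar_continuous_on; intros x Hx; lra |].
    intros k Hk. replace k with 1%nat by lia. apply ustar_C1_class; auto.
  - split; [apply ustar_continuous_on; intros x [Hx _]; lra |].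
    intros k Hk. assert (Hk' : k = 1%nat \/ k = 2%nat) by lia.
    destruct Hk' as [-> | ->]; [apply ustar_C1_class; intros x [Hx _]; exact Hx |].
    split.
    + intros x [_ HD] Hx.
      apply ex_derive_ext_loc with dU; [| apply locally_singleton, uext_C2; assumption].
      generalize (Derive_ustar_locally x Hx). apply filter_imp.
      intros y Hy; symmetry; exact Hy.
    + exists ddu_closure. split.
      * apply continuous_on_of_continuous. intros x [Hx HD].
        apply ddu_closure_continuous; assumption.
      * intros x _ Hx. unfold ddu_closure. destruct (Rlt_dec 0 x) as [L | L]; [| lra].
        symmetry. apply (Derive_ext_loc (Derive ustar) dU x), Derive_ustar_locally, Hx.
Qed.

Lemma opA_ustar (x : R) : 0 <= x < 1 -> opA eps ustar x = opA eps U x.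
Proof.
  intros Hx. unfold opA. rewrite ustar_eq; [reflexivity |].
  split; [apply g_nonneg, Hx | apply g_lt_1; lra].
Qed.

Lemma opL_ustar (x : R) : 0 < x < 1 -> opL lambda gam ustar x = opL lambda gam U x.
Proof.
  intros Hx. unfold opL. rewrite (Derive_ustar x Hx).
  rewrite (Derive_n_ext_loc ustar U 2 x (ustar_locally x Hx)). reflexivity.
Qed.

Lemma ustar_solves_fbp : solves_fbp lambda beta gam eps ustar a.
Proof.
  assert (Ha := a_bounds).
  split; [exact Ha |]. split; [apply ustar_regular |].
  split; [| split; [| split; [| split; [| split]]]].
  - intros x Hx. rewrite opL_ustar by lra. apply opL_uext_below, Hx.
  - intros x Hx. rewrite ustar_eq, opA_ustar by lra. apply uext_above, Hx.
  - rewrite Derive_ustar by exact Ha. rewrite Derive_uext_above by lra.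
    symmetry. apply is_derive_unique.
    apply is_derive_ext_loc with (opA eps U).
    + generalize (locally_between a 0 1 Ha). apply filter_imp. intros y Hy.
      symmetry; apply opA_ustar; lra.
    + apply opA_is_derive; [lra |]. intros _. apply uext_is_derive, g_lt_1; lra.
  - exists (Rabs (dU 0)).
    apply filterlim_ext_loc with (fun x => Rabs (dU x)).
    + change (locally 0 (fun y => 0 < y -> Rabs (dU y) = Rabs (Derive ustar y))).
      generalize (locally_lt 0 1 Rlt_0_1). apply filter_imp. intros y Hy Hy0.
      rewrite Derive_ustar by lra. reflexivity.
    + apply (filterlim_within (fun x => Rabs (dU x))).
      apply (continuous_comp dU Rabs); [apply Derive_uext_continuous; lra |].
      apply continuous_Rabs.
  - intros x Hx HD. rewrite opL_ustar by exact Hx. apply Rle_ge, opL_uext_ge; assumption.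
  - intros x Hx. rewrite ustar_eq, opA_ustar by exact Hx. apply uext_le_opA, Hx.
Qed.

End Solution.

(** * Uniqueness for the free boundary problem *)

Section Uniqueness.

Context (v : R -> R) (b : R) (Hv : solves_fbp lambda beta gam eps v b).

Lemma fbp_b_bounds : 0 < b < 1.
Proof. exact (proj1 Hv). Qed.

Lemma fbp_ex_derive (x : R) : 0 < x < 1 -> ex_derive v x.
Proof.
  intros Hx. destruct Hv as [_ [[_ [[_ H] _]] _]].
  destruct (H 1%nat ltac:(lia)) as [H1 _]. apply (H1 x ltac:(lra) Hx).
Qed.

Lemma fbp_Derive_continuous (x : R) : 0 < x < 1 -> continuous (Derive v) x.
Proof.
  intros Hx. destruct Hv as [_ [[_ [[_ H] _]] _]].
  destruct (H 1%nat ltac:(lia)) as [_ [w [Hw E]]].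
  assert (Hl := locally_between x 0 1 Hx).
  apply continuous_ext_loc with w.
  - revert Hl. apply filter_imp. intros y Hy. apply (E y); lra.
  - apply continuous_continuous_on with (2 := Hw).
    revert Hl. apply filter_imp. intros y Hy. lra.
Qed.

(** No point of [setD] lies below [b], so v'' exists there and L v = - beta x can be solved for it;
    this is the equation satisfied by [psi]. *)
Lemma fbp_ode (x : R) : 0 < x < b ->
  is_derive (Derive v) x (- dh x * (r * x / (1 - x) + Derive v x)).
Proof.
  intros Hx. assert (Hb := fbp_b_bounds).
  destruct Hv as [_ [[_ [_ [_ H]]] [HL _]]].
  destruct (H 2%nat ltac:(lia)) as [H2 _].
  assert (Hex : ex_derive (Derive v) x).
  { apply (H2 x); [| lra]. split; [lra |]. apply not_setD_below; lra. }
  apply (is_derive_eq _ _ _ _ (Derive_correct _ _ Hex)).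
  assert (E := HL x Hx). unfold opL in E.
  change (Derive_n v 2 x) with (Derive (Derive v) x) in E.
  apply Rmult_eq_reg_l with (gam * x ^ 2 * (1 - x) ^ 2).
  - replace (gam * x ^ 2 * (1 - x) ^ 2 * Derive (Derive v) x)
      with (- beta * x - lambda * (1 - x) * Derive v x) by lra.
    unfold dh, r. field. lra.
  - apply Rgt_not_eq. repeat apply Rmult_lt_0_compat; try lra; apply pow_lt; lra.
Qed.

(* [exp h (v' - psi)] is constant and, [v'] being bounded near 0, tends to 0. *)
Lemma fbp_Derive_below (x : R) : 0 < x < b -> Derive v x = psi x.
Proof.
  intros Hx. assert (Hb := fbp_b_bounds). assert (Hr := rho_pos). fold rho in Hr.
  set (f := fun y => exp (h y) * (Derive v y - psi y)).
  assert (Hf : forall y, 0 < y < b -> is_derive f y 0).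
  { intros y Hy.
    assert (H1 := is_derive_minus _ _ y _ _ (fbp_ode y Hy) (psi_is_derive y ltac:(lra))).
    assert (H2 := is_derive_mult _ _ y _ _ (exp_h_is_derive y ltac:(lra)) H1 Rmult_comm).
    apply (is_derive_eq _ _ _ _ H2). unfold minus, plus, opp, mult, dpsi; simpl. ring. }
  assert (Hbd : exists d M, 0 < d /\ forall y, 0 < y < d -> Rabs (f y) <= M * y).
  { destruct Hv as [_ [_ [_ [_ [_ [[l Hl] _]]]]]].
    assert (Hl1 : locally 0 (fun y => 0 < y -> ball l 1 (Rabs (Derive v y)))).
    { exact (proj1 (filterlim_locally _ _) Hl (mkposreal 1 Rlt_0_1)). }
    destruct Hl1 as [d Hd].
    exists (Rmin d (1 / 2)), (4 / rho ^ 2 * (Rabs l + 1 - psi (1 / 2))).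
    split; [apply Rmin_glb_lt; [apply cond_pos | lra] |]. intros y Hy.
    generalize (Rmin_l d (1 / 2)) (Rmin_r d (1 / 2)); intros Hm1 Hm2.
    assert (Hvy : Rabs (Derive v y) <= Rabs l + 1).
    { assert (Q : Rabs (Rabs (Derive v y) - l) < 1).
      { apply Hd; [| lra]. change (Rabs (y - 0) < d). rewrite Rminus_0_r, Rabs_pos_eq; lra. }
      apply Rabs_def2 in Q. generalize (Rle_abs l); lra. }
    unfold f. rewrite Rabs_mult, (Rabs_pos_eq (exp (h y))) by (left; apply exp_pos).
    replace (4 / rho ^ 2 * (Rabs l + 1 - psi (1 / 2)) * y)
      with (4 / rho ^ 2 * y * (Rabs l + 1 - psi (1 / 2))) by ring.
    apply Rmult_le_compat.
    - left; apply exp_pos.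
    - apply Rabs_pos.
    - apply exp_h_le_lin; lra.
    - eapply Rle_trans; [apply Rabs_triang |]. rewrite Rabs_Ropp, (Rabs_left1 (psi y)).
      + generalize (psi_nonincreasing y (1 / 2) ltac:(lra) ltac:(lra)). lra.
      + apply psi_le_0; lra. }
  destruct Hbd as [d [M [Hd HM]]].
  assert (H1 : 0 <= f x).
  { apply (nonneg_of_derive_nonneg f (fun _ => 0) b d M); try assumption.
    - intros; lra.
    - intros y Hy. generalize (HM y Hy); intros Q. apply Rabs_le_between in Q. lra. }
  assert (H2 : 0 <= - f x).
  { apply (nonneg_of_derive_nonneg (fun y => - f y) (fun _ => 0) b d M); try assumption.
    - intros y Hy. apply (is_derive_eq _ _ _ _ (is_derive_opp _ _ _ (Hf y Hy))).
      apply Ropp_0.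
    - intros; lra.
    - intros y Hy. generalize (HM y Hy); intros Q. apply Rabs_le_between in Q. lra. }
  unfold f in H1, H2. rewrite Ropp_mult_distr_r in H2.
  apply nonneg_of_exp_mult in H1. apply nonneg_of_exp_mult in H2. lra.
Qed.

Lemma fbp_filterlim_0 : filterlim v (at_right 0) (locally (v 0)).
Proof.
  destruct Hv as [_ [[[H _] _] _]].
  intros P HP. specialize (H 0 ltac:(lra) P HP).
  change (locally 0 (fun y => 0 < y -> P (v y))).
  change (locally 0 (fun y => 0 <= y <= 1 -> P (v y))) in H.
  generalize (filter_and _ _ H (locally_lt 0 1 Rlt_0_1)). apply filter_imp.
  intros y [Hy Hy1] Hy0. apply Hy; lra.
Qed.

Lemma fbp_below (x : R) : 0 <= x < b -> v x = Psi x + v 0.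
Proof.
  assert (Hb := fbp_b_bounds).
  assert (Hconst : forall x y, 0 < x < b -> 0 < y < b -> x < y -> v y - Psi y = v x - Psi x).
  { intros y z Hy Hz L.
    destruct (mean_value (fun y => v y - Psi y) (fun _ => 0) y z L) as [c [_ E]]; [| lra].
    intros t Ht.
    assert (H := is_derive_minus _ _ t _ _ (Derive_correct _ _ (fbp_ex_derive t ltac:(lra)))
      (Psi_is_derive t ltac:(lra))).
    apply (is_derive_eq _ _ _ _ H). rewrite fbp_Derive_below by lra.
    unfold minus, plus, opp; simpl. ring. }
  set (K := v (b / 2) - Psi (b / 2)).
  assert (HK : forall x, 0 < x < b -> v x = Psi x + K).
  { intros y Hy. unfold K. destruct (Rtotal_order y (b / 2)) as [L | [-> | L]].
    - generalize (Hconst y (b / 2) Hy ltac:(lra) L). lra.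
    - ring.
    - generalize (Hconst (b / 2) y ltac:(lra) Hy L). lra. }
  (* [v] is continuous at 0 only relative to [0, 1], so the constant is identified through the right
     limit. *)
  assert (HK0 : v 0 = Psi 0 + K).
  { apply (filterlim_locally_unique (F := at_right 0) v); [apply fbp_filterlim_0 |].
    apply filterlim_ext_loc with (fun y => Psi y + K).
    - change (locally 0 (fun y => 0 < y -> Psi y + K = v y)).
      generalize (locally_lt 0 b (proj1 Hb)). apply filter_imp. intros y Hy Hy0.
      symmetry; apply HK; lra.
    - apply (filterlim_within (fun y => Psi y + K)).
      apply (continuous_of_is_derive _ _ _ (V_is_derive K 0 Rlt_0_1)). }
  rewrite Psi_0, Rplus_0_l in HK0. rewrite HK0.
  intros [[Hx | <-] Hxb]; [apply HK; lra |]. rewrite Psi_0. lra.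
Qed.

(** The equations are v = A v and v' = (A v)' at [b]. Since [g b < b], the right sides involve only
    the explicit branch; the left sides are limits of that branch from below. *)
Lemma fbp_solves_system : solves_system lambda beta gam eps (v 0) b.
Proof.
  assert (Hb := fbp_b_bounds).
  assert (Hg0 := g_nonneg b ltac:(lra)). assert (Hgb := g_lt b Hb).
  assert (E0 : v b = Psi b + v 0).
  { apply (eq_of_eq_left v (fun y => Psi y + v 0) 0 b (proj1 Hb)).
    - intros x Hx. apply fbp_below; lra.
    - apply (ex_derive_continuous v), fbp_ex_derive, Hb.
    - apply (continuous_of_is_derive _ _ _ (V_is_derive (v 0) b (proj2 Hb))). }
  assert (E1 : Derive v b = psi b).
  { apply (eq_of_eq_left (Derive v) psi 0 b (proj1 Hb)).
    - apply fbp_Derive_below.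
    - apply fbp_Derive_continuous, Hb.
    - apply psi_continuous; lra. }
  assert (Eg : v (g eps b) = Psi (g eps b) + v 0) by (apply fbp_below; lra).
  destruct Hv as [_ [_ [_ [HA [HD _]]]]].
  split; [exact Hb |]. split.
  - rewrite (Rplus_comm (v 0)), <- E0, (HA b) by lra. unfold opA. rewrite Eg. ring.
  - rewrite <- E1, HD.
    rewrite (is_derive_unique _ _ _ (opA_is_derive v b (psi (g eps b)) (proj2 Hb)
      (fun He => is_derive_eq _ _ _ _
        (Derive_correct _ _ (fbp_ex_derive _ (conj (g_pos b He Hb) (g_lt_1 b (proj2 Hb)))))
        (fbp_Derive_below _ (conj (g_pos b He Hb) Hgb))))).
    rewrite Eg. unfold gden. ring.
Qed.

(** Both functions obey the same recursion from the same values below [b], and both are left limits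
    at 1. *)
Lemma fbp_eq_ustar (x : R) : 0 <= x <= 1 -> v x = u lambda beta gam eps (v 0) b x.
Proof.
  assert (Hb := fbp_b_bounds). assert (Hs := fbp_solves_system).
  assert (H : forall y, 0 <= y < 1 -> v y = uext (v 0) b y).
  { intros y [Hy Hy1]. revert Hy. revert y Hy1.
    apply (g_induction b (fun y => 0 <= y -> v y = uext (v 0) b y) Hb).
    - intros y Hy Hy0. rewrite (uext_below _ _ Hs) by exact Hy. apply fbp_below; lra.
    - intros y Hy IH Hy0. rewrite (uext_above _ _ Hs) by exact Hy.
      destruct Hv as [_ [_ [_ [HA _]]]]. rewrite HA by exact Hy.
      unfold opA. rewrite IH; [reflexivity | apply g_nonneg; lra]. }
  intros [Hx [Hx1 | ->]].
  - rewrite (ustar_eq _ _ ) by lra. apply H; lra.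
  - destruct (ustar_from_1 _ _ Hs) as [l [Hl E]]. rewrite E by lra.
    apply (filterlim_locally_unique (F := at_left 1) v).
    + destruct Hv as [_ [[[Hc _] _] _]].
      intros P HP. specialize (Hc 1 ltac:(lra) P HP).
      change (locally 1 (fun y => y < 1 -> P (v y))).
      change (locally 1 (fun y => 0 <= y <= 1 -> P (v y))) in Hc.
      generalize (filter_and _ _ Hc (locally_gt 1 0 Rlt_0_1)). apply filter_imp.
      intros y [Hy Hy0] Hy1. apply Hy; lra.
    + apply filterlim_ext_loc with (uext (v 0) b); [| exact Hl].
      change (locally 1 (fun y => y < 1 -> uext (v 0) b y = v y)).
      generalize (locally_gt 1 0 Rlt_0_1). apply filter_imp. intros y Hy Hy1.
      symmetry; apply H; lra.
Qed.

End Uniqueness.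

End ExplicitSolution.

Theorem theorem4p8 :
  forall lambda beta mu sigma eps : R,
  0 < lambda -> 0 < beta -> 0 < sigma -> 0 <= eps < 1 -> mu <> 0 ->
  (exists! p : R * R,
     solves_system lambda beta (gamma mu sigma) eps (fst p) (snd p)) /\
  forall C astar : R,
  solves_system lambda beta (gamma mu sigma) eps C astar ->
  let ustar := u lambda beta (gamma mu sigma) eps C astar in
  (solves_fbp lambda beta (gamma mu sigma) eps ustar astar /\
   forall (v : R -> R) (b : R),
     solves_fbp lambda beta (gamma mu sigma) eps v b ->
     b = astar /\ forall x, 0 <= x <= 1 -> v x = ustar x) /\
  0 < astar < 1 /\
  concave_on (fun x => 0 <= x <= 1) ustar /\
  regular eps astar ustar.
Proof.
  intros lambda beta mu sigma eps Hl Hb Hs He Hmu.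
  assert (Hg : 0 < gamma mu sigma).
  { unfold gamma. apply Rdiv_lt_0_compat.
    - apply pow2_gt_0, Hmu.
    - apply Rmult_lt_0_compat; [lra | apply pow_lt, Hs]. }
  assert (Hex := system_exists_unique lambda beta (gamma mu sigma) Hl Hb Hg eps He).
  split; [exact Hex |].
  intros C astar Hsol ustar.
  split; [split | split; [exact (proj1 Hsol) | split]].
  - apply ustar_solves_fbp; assumption.
  - intros v b Hv.
    assert (Hsys := fbp_solves_system lambda beta (gamma mu sigma) Hl Hb Hg eps He v b Hv).
    (* Both [(C, astar)] and [(v 0, b)] solve the system, hence coincide. *)
    destruct Hex as [[C0 a0] [_ Huniq]].
    assert (E1 := Huniq (C, astar) Hsol). assert (E2 := Huniq (v 0, b) Hsys).
    rewrite E1 in E2. injection E2 as E2 E3.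
    split; [symmetry; exact E3 |]. intros x Hx. unfold ustar. rewrite E2, E3.
    apply fbp_eq_ustar; assumption.
  - apply ustar_concave; assumption.
  - apply ustar_regular; assumption.
Qed.
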